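(* Let the standing assumptions of the context hold with $C=\mathbb R^n$ (i.e. $h$ has full domain), let $(\gamma,\beta,c,\xi)$ be admissible, let $x^{-1},x^0\in\mathbb R^n$ and let $(x^k)_{k\in\mathbb N}$ satisfy $x^{k+1}\in T_{\gamma,\beta}(x^k,x^{k-1})$ for all $k\ge0$ (a sequence generated by the $i^*$FRB algorithm). For $k\in\mathbb N$ let $z^k=(x^{k+1},x^k,x^{k-1})$ and let $\omega(z^0)$ be the set of limit points of $(z^k)_{k\in\mathbb N}$. Define, for $w,x,x^-\in\mathbb R^n$, $$\mathcal F(w,x,x^-)=\mathcal M_{\gamma,\beta}(w;x,x^-)+\tfrac{c}{2\gamma}D_h(x,x^-)+D_\xi(x,x^-).$$ Assume in addition: (a) $\varphi$ is level bounded; (b) $f,h$ are twice continuously differentiable and $\nabla^2h$ is positive definite; (c) there exist $r>0$ and $\eta\in(0,\infty]$ such that $\mathcal F$ satisfies the (setwise) generalized concave Kurdyka–Łojasiewicz property on $\Omega=\omega(z^0)$ with respect to $U=\Omega_r$ and $\eta$. Let $x^\star$ be the limit of $(x^k)$ (whose existence under these assumptions is the paper's sequential convergence theorem), let $e_k=\mathcal L_{\gamma,\beta}(x^{k+1},x^k)-\varphi^\star$ for $k\in\mathbb N$, and assume that $\mathcal F$ has KL exponent $\theta\in[0,1)$ at $(x^\star,x^\star,x^\star)$. Then: (i) If $\theta=0$, then $e_k\to0$ and $x^k\to x^\star$ after finitely many steps. (ii) If $\theta\in(0,\frac12]$, then there exist $c_1,\hat c_1>0$ and $Q_1,\hat Q_1\in[0,1)$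 such that for $k$ sufficiently large, $e_k\le\hat c_1\hat Q_1^k$ and $\|x^k-x^\star\|\le c_1Q_1^k$. (iii) If $\theta\in(\frac12,1)$, then there exist $c_2,\hat c_2>0$ such that for $k$ sufficiently large, $e_k\le\hat c_2k^{-\frac1{2\theta-1}}$ and $\|x^k-x^\star\|\le c_2k^{-\frac{1-\theta}{2\theta-1}}$.
   Context: Conventions: $\overline{\mathbb R}=\mathbb R\cup\{\pm\infty\}$, $\infty-\infty=\infty$, $1/0=\infty$; $\operatorname{dom}F=\{F<\infty\}$; $\operatorname{argmin}F=\{w: F(w)\le F(z)\ \forall z\}$. Level bounded: all sublevel sets bounded. 1-coercive: $F(x)/\|x\|\to\infty$ as $\|x\|\to\infty$. $\partial$ denotes the limiting (Mordukhovich) subdifferential; $\operatorname{dist}(0,\emptyset)=\infty$. ''Limit point'' means cluster point. Kernel. $C\subseteq\mathbb R^n$ is a nonempty open convex set with closure $\overline C$, and $h:\mathbb R^n\to\overline{\mathbb R}$ is a Legendre kernel: proper, lsc, strictly convex, 1-coercive, differentiable on $C$, with $\operatorname{dom}\nabla h=\operatorname{int}\operatorname{dom}h=C$, and essentially smooth ($\|\nabla h(x_k)\|\to\infty$ for every sequence in $C$ converging to a boundary point of $C$). For $\psi$ differentiable on $C$ (not necessarily convex) and $y\in C$, $D_\psi(x,y):=\psi(x)-\psi(y)-\langle\nabla\psi(y),x-y\rangle$. Problem and standing assumptions. $\varphi:=f+g$ and $\varphi_{\overline C}:=\varphi+\delta_{\overline C}$ ($\delta$ the indicator function). (1) $f:\mathbb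 R^n\to\overline{\mathbb R}$ is proper, lsc, differentiable on $\operatorname{int}\operatorname{dom}f\ne\emptyset$, and smooth relative to $h$: $\operatorname{dom}f\supseteq\operatorname{dom}h$ and $Lh\pm f$ are convex on $C$ for some $L\ge0$. (2) $g:\mathbb R^n\to\overline{\mathbb R}$ is proper and lsc. (3) $\inf\varphi_{\overline C}>-\infty$. (4) For all $v\in\mathbb R^n$, $\gamma>0$: $\operatorname{argmin}\{\gamma g+h-\langle v,\cdot\rangle\}\subseteq C$. Constants. Fix $\sigma_{f,h},\sigma_{-f,h}\in\mathbb R$ such that $f-\sigma_{f,h}h$ and $-f-\sigma_{-f,h}h$ are convex on $C$. $L_{f,h}:=\max\{|\sigma_{f,h}|,|\sigma_{-f,h}|\}$, assumed positive ($f$ not affine); $p_{\pm f,h}:=\sigma_{\pm f,h}/L_{f,h}$; $\alpha:=\gamma L_{f,h}$ for a stepsize $\gamma>0$. Model, operator, envelope. For $\gamma>0$, $\beta\in\mathbb R$ let $\hat h:=\frac1\gamma h-f$, $\hat f_\beta:=f-\frac\beta\gamma h$, and for $w\in\mathbb R^n$, $x,x^-\in C$, $$\mathcal M_{\gamma,\beta}(w;x,x^-):=\varphi(w)+D_{\hat h}(w,x)+\langle w-x,\nabla\hat f_\beta(x)-\nabla\hat f_\beta(x^-)\rangle,$$ $T_{\gamma,\beta}(x,x^-):=\operatorname{argmin}_w\mathcal M_{\gamma,\beta}(w;x,x^-)$, $\Phi_{\gamma,\beta}(x,x^-):=\inf_w\mathcal M_{\gamma,\beta}(w;x,x^-)$.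 The step $x^{k+1}\in T_{\gamma,\beta}(x^k,x^{k-1})$ is equivalent to: let $y^k$ satisfy $\nabla h(y^k)=\nabla h(x^k)-\gamma(\nabla f(x^k)-\nabla f(x^{k-1}))$ and choose $x^{k+1}\in\operatorname{argmin}_w\{g(w)+\langle w,\nabla f(x^k)-\frac\beta\gamma(\nabla h(x^k)-\nabla h(x^{k-1}))\rangle+\frac1\gamma D_h(w,y^k)\}$. Admissible parameters. $(\gamma,\beta,c,\xi)$ with $\gamma>0$, $\beta\in\mathbb R$ is admissible if either (A) $\hat f_\beta$ is convex on $C$ (i.e. $\alpha p_{f,h}-\beta\ge0$), $\beta>-\frac{1+3\alpha p_{-f,h}}2$, $\xi=\hat f_\beta$ and $c=1+2\beta+3\alpha p_{-f,h}>0$; or (B) $\nabla\hat f_\beta$ is $L_{\hat f_\beta}$-Lipschitz on $C$, $h$ is $\sigma_h$-strongly convex ($\sigma_h>0$), $\xi=\frac{L_{\hat f_\beta}}2\|\cdot\|^2$ and $c=(1+\alpha p_{-f,h})\sigma_h-2\gamma L_{\hat f_\beta}>0$. In either case $\mathcal L_{\gamma,\beta}(x,x^-):=\Phi_{\gamma,\beta}(x,x^-)+\frac c{2\gamma}D_h(x,x^-)+D_\xi(x,x^-)$ on $C\times C$. The number $\varphi^\star$ is $\varphi^\star:=\lim_k\mathcal L_{\gamma,\beta}(x^k,x^{k-1})$ (the paper establishes that this limit exists under admissibility and that, under assumptions (a)–(c), $\mathcal F$ is constantly equal to $\varphi^\star$ on $\omega(z^0)$). Generalized concave KL property. For $\eta\in(0,\infty]$,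 $\Psi_\eta$ is the class of functions $\psi:[0,\eta)\to\mathbb R_+$ that are right-continuous at $0$ with $\psi(0)=0$ and strictly increasing on $[0,\eta)$. Let $F:\mathbb R^m\to\overline{\mathbb R}$ be proper lsc. Setwise version: if $V\subseteq\operatorname{dom}\partial F$ is nonempty with $F\equiv\mu$ on $V$, $F$ has the generalized concave KL property on $V$ with respect to $U\supset V$ and $\eta$ if there is a concave $\psi\in\Psi_\eta$ such that for every $x\in U$ with $0<F(x)-\mu<\eta$: $\psi'_-(F(x)-\mu)\cdot\operatorname{dist}(0,\partial F(x))\ge1$ ($\psi'_-$ the left derivative). Pointwise version at $\bar x\in\operatorname{dom}\partial F$: there exist a neighborhood $U$ of $\bar x$, $\eta\in(0,\infty]$ and a concave $\psi\in\Psi_\eta$ such that the same inequality holds with $\mu=F(\bar x)$ for all $x\in U$ with $0<F(x)-F(\bar x)<\eta$; such a $\psi$ is called a desingularizing function. $F$ has KL exponent $\theta\in[0,1)$ at $\bar x$ if the pointwise property holds with a desingularizing function of the form $\psi(t)=\kappa t^{1-\theta}$ for some $\kappa>0$. $\Omega_r:=\{z:\operatorname{dist}(z,\Omega)<r\}$. *)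

(* Defs.v *)
From HB Require Import structures.
From mathcomp Require Import all_boot all_order all_algebra.
From mathcomp Require Import all_classical all_reals all_analysis.

Set Implicit Arguments.
Unset Strict Implicit.
Unset Printing Implicit Defensive.

Import Order.TTheory GRing.Theory Num.Theory.
Import numFieldNormedType.Exports.

Local Open Scope classical_set_scope.
Local Open Scope ring_scope.

(* Sums of extended reals are written in the scope %dE, whose addition
   satisfies +oo - oo = +oo (the default one has +oo - oo = -oo). *)

(* The library norm on 'rV[R]_m is the sup norm.  It is used below only through
   the topology and the bounded sets it induces, which are the Euclidean ones;
   every metric quantity is expressed with enorm. *)
Section Euclidean.
Context {R : realType} {m : nat}.
Implicit Types (u v x y : 'rV[R]_m) (F : 'rV[R]_m -> \bar R).

Definition dot u v : R := \sum_(i < m) u 0 i * v 0 i.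

Definition enorm u : R := Num.sqrt (dot u u).

(* dist(x, set0) = +oo *)
Definition dist_set x (A : set 'rV[R]_m) : \bar R :=
  ereal_inf [set (enorm (x - y))%:E | y in A].

Definition edom F : set 'rV[R]_m := [set x | (F x < +oo)%E].

Definition eproper F : Prop := (forall x, F x != -oo%E) /\ edom F !=set0.

Definition argmin F : set 'rV[R]_m := [set w | forall z, (F w <= F z)%E].

Definition indicator (A : set 'rV[R]_m) x : \bar R :=
  if x \in A then 0%E else +oo%E.

Definition level_bounded F : Prop :=
  forall a : R, bounded_set [set x | (F x <= a%:E)%E].

(* convex_on, differentiable_at and grad go through fine, so they say something
   about F only on sets (or near points) where F is finite; they are only used
   there. *)
Definition convex_on (D : set 'rV[R]_m) F : Prop :=
  convex_function (D : set (convex_lmodType _)) (fine \o F).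

Definition differentiable_at F x : Prop := differentiable (fine \o F) x.

Definition grad F x : 'rV[R]_m :=
  \row_(i < m) 'D_(delta_mx 0 i) (fine \o F) x.

Definition hess F x : 'M[R]_m := 'J (grad F) x.

Definition twice_cont_diff F : Prop :=
  [/\ forall x, differentiable_at F x,
      forall x, differentiable (grad F) x & continuous (hess F)].

Definition pos_def (A : 'M[R]_m) : Prop :=
  forall u, u != 0 -> 0 < dot (u *m A) u.

Definition dom_grad F : set 'rV[R]_m :=
  [set x | (edom F)° x /\ differentiable_at F x].

Definition strictly_convex F : Prop :=
  forall x y (t : R), edom F x -> edom F y -> x != y -> 0 < t < 1 ->
    (F (t *: x + (1 - t) *: y)%R < t%:E * F x + (1 - t)%:E * F y)%dE.

Definition strongly_convex (s : R) F : Prop :=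
  convex_on (edom F) (fun x => F x - (s / 2 * enorm x ^+ 2)%:E)%dE.

Definition coercive1 F : Prop :=
  forall A : R, exists M : R, 0 < M /\
    forall x, M <= enorm x -> (A%:E <= F x * ((enorm x)^-1)%:E)%E.

Definition bregman F x y : \bar R :=
  (F x - F y - (dot (grad F y) (x - y))%:E)%dE.

End Euclidean.

Section LimitingSubdifferential.
Context {R : realType} {m : nat}.
Implicit Types (F : 'rV[R]_m -> \bar R) (x v : 'rV[R]_m).

(* liminf (F y - F x - <v, y - x>) / |y - x| >= 0 as y -> x, y != x *)
Definition frechet_subdiff F x : set 'rV[R]_m :=
  [set v | F x \is a fin_num /\ forall e : R, 0 < e -> \forall y \near x,
     (F x + (dot v (y - x) - e * enorm (y - x))%:E <= F y)%E].

Definition limiting_subdiff F x : set 'rV[R]_m :=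
  [set v | F x \is a fin_num /\ exists (xs vs : nat -> 'rV[R]_m),
     [/\ xs @ \oo --> x, F (xs k) @[k --> \oo] --> F x, vs @ \oo --> v
       & forall k, frechet_subdiff F (xs k) (vs k)]].

Definition dom_subdiff F : set 'rV[R]_m :=
  [set x | limiting_subdiff F x !=set0].

End LimitingSubdifferential.

Section KurdykaLojasiewicz.
Context {R : realType} {m : nat}.
Implicit Types (F : 'rV[R]_m -> \bar R) (x : 'rV[R]_m) (V U : set 'rV[R]_m)
  (eta : \bar R) (psi : R -> R).

Definition left_derivative psi (t : R) : R :=
  lim ((psi (t + s) - psi t) / s @[s --> (0 : R)^'-]).

(* the interval [0, eta), where eta may be +oo *)
Definition desing_dom eta : set R := [set t | 0 <= t /\ (t%:E < eta)%E].

(* a function on [0, eta) is represented by any of its extensions to R *)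
Definition desing_class eta psi : Prop :=
  [/\ psi 0 = 0, psi t @[t --> (0 : R)^'+] --> psi 0,
      forall t, desing_dom eta t -> 0 <= psi t
    & forall s t, desing_dom eta s -> desing_dom eta t -> s < t ->
        psi s < psi t].

Definition concave_desing eta psi : Prop :=
  desing_class eta psi /\
  convex_function (desing_dom eta : set (convex_lmodType R^o))
    (fun t => - psi t).

Definition KL_inequality F (mu : R) U eta psi : Prop :=
  forall x, U x -> (0 < F x - mu%:E)%E -> (F x - mu%:E < eta)%E ->
    (1 <= (left_derivative psi (fine (F x) - mu))%:E
          * dist_set 0%R (limiting_subdiff F x))%E.

Definition KL_on_set F V U eta : Prop :=
  exists mu : R,
    [/\ V !=set0, V `<=` dom_subdiff F, (forall x, V x -> F x = mu%:E),
        V `<=` U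
      & exists psi, concave_desing eta psi /\ KL_inequality F mu U eta psi].

Definition desingularizing_at F x psi : Prop :=
  dom_subdiff F x /\ exists U eta,
    [/\ nbhs x U, (0 < eta)%E, concave_desing eta psi
      & KL_inequality F (fine (F x)) U eta psi].

Definition KL_exponent F x (theta : R) : Prop :=
  0 <= theta < 1 /\ exists2 kappa : R, 0 < kappa &
    desingularizing_at F x (fun t => kappa * t `^ (1 - theta)).

End KurdykaLojasiewicz.

Section Assumptions.
Context {R : realType} {n : nat}.
Local Notation V := 'rV[R]_n.
Implicit Types (f g h xi : V -> \bar R) (C : set V).

Record legendre_kernel C h : Prop := LegendreKernel {
  kernel_proper : eproper h;
  kernel_lsc : lower_semicontinuous h;
  kernel_strictly_convex : strictly_convex h;
  kernel_coercive : coercive1 h;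
  kernel_dom_grad : dom_grad h = C;
  kernel_int_dom : (edom h)° = C;
  kernel_essentially_smooth : forall (u : nat -> V) (x : V),
    (forall k, C (u k)) -> u @ \oo --> x -> (closure C `\` C°) x ->
    enorm (grad h (u k)) @[k --> \oo] --> +oo
}.

Definition phi f g : V -> \bar R := fun x => (f x + g x)%dE.

Definition phi_closure C f g : V -> \bar R :=
  fun x => (phi f g x + indicator (closure C) x)%dE.

Record standing_assumptions C f g h : Prop := StandingAssumptions {
  domain_nonempty : C !=set0;
  domain_open : open C;
  domain_convex : convex_set (C : set (convex_lmodType _));
  kernel_legendre : legendre_kernel C h;
  f_proper : eproper f;
  f_lsc : lower_semicontinuous f;
  f_int_dom : (edom f)° !=set0;
  f_differentiable : forall x, (edom f)° x -> differentiable_at f x;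
  f_dom : edom h `<=` edom f;
  f_relatively_smooth : exists2 L : R, 0 <= L &
    convex_on C (fun x => L%:E * h x + f x)%dE /\
    convex_on C (fun x => L%:E * h x - f x)%dE;
  g_proper : eproper g;
  g_lsc : lower_semicontinuous g;
  phi_lower_bounded : (-oo < ereal_inf (range (phi_closure C f g)))%E;
  subproblem_argmin : forall (v : V) (gamma : R), 0 < gamma ->
    argmin (fun w => gamma%:E * g w + h w - (dot v w)%:E)%dE `<=` C
}.

(* sf and smf stand for the moduli sigma_{f,h} and sigma_{-f,h} *)
Definition relative_moduli C f h (sf smf : R) : Prop :=
  convex_on C (fun x => f x - sf%:E * h x)%dE /\
  convex_on C (fun x => - f x - smf%:E * h x)%dE.

Definition Lfh (sf smf : R) : R := Num.max `|sf| `|smf|.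

Definition hhat f h (gamma : R) : V -> \bar R :=
  fun x => ((gamma^-1)%:E * h x - f x)%dE.

Definition fhat f h (gamma beta : R) : V -> \bar R :=
  fun x => (f x - (beta / gamma)%:E * h x)%dE.

Definition admissible_A C f h (sf smf gamma beta c : R) xi : Prop :=
  let alpha := gamma * Lfh sf smf in
  let p_mf := smf / Lfh sf smf in
  [/\ convex_on C (fhat f h gamma beta),
      - ((1 + 3 * (alpha * p_mf)) / 2) < beta,
      xi = fhat f h gamma beta,
      c = 1 + 2 * beta + 3 * (alpha * p_mf) & 0 < c].

Definition admissible_B C f h (sf smf gamma beta c : R) xi : Prop :=
  let alpha := gamma * Lfh sf smf in
  let p_mf := smf / Lfh sf smf in
  exists (Lhat sh : R), [/\ 0 <= Lhat, 0 < sh & [/\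
      (forall x y, C x -> C y ->
         enorm (grad (fhat f h gamma beta) x - grad (fhat f h gamma beta) y)
           <= Lhat * enorm (x - y)),
      strongly_convex sh h,
      xi = (fun x => (Lhat / 2 * enorm x ^+ 2)%:E),
      c = (1 + alpha * p_mf) * sh - 2 * gamma * Lhat & 0 < c]].

Definition admissible C f h (sf smf gamma beta c : R) xi : Prop :=
  0 < gamma /\ (admissible_A C f h sf smf gamma beta c xi \/
                admissible_B C f h sf smf gamma beta c xi).

End Assumptions.

Section Algorithm.
Context {R : realType} {n : nat}.
Local Notation V := 'rV[R]_n.
Implicit Types (f g h xi : V -> \bar R) (w x xm : V) (gamma beta c : R).

(* xm stands for the previous iterate x^- *)
Definition model f g h gamma beta x xm : V -> \bar R := fun w =>
  (phi f g w + bregman (hhat f h gamma) w x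
   + (dot (w - x) (grad (fhat f h gamma beta) x
                   - grad (fhat f h gamma beta) xm))%:E)%dE.

Definition iFRB_step f g h gamma beta x xm : set V :=
  argmin (model f g h gamma beta x xm).

Definition envelope f g h gamma beta x xm : \bar R :=
  ereal_inf (range (model f g h gamma beta x xm)).

Definition merit f g h gamma beta c xi x xm : \bar R :=
  (envelope f g h gamma beta x xm + (c / (2 * gamma))%:E * bregman h x xm
   + bregman xi x xm)%dE.

Definition potential f g h gamma beta c xi w x xm : \bar R :=
  (model f g h gamma beta x xm w + (c / (2 * gamma))%:E * bregman h x xm
   + bregman xi x xm)%dE.

(* R^n x R^n x R^n is identified with R^(3n), so that its Euclidean structure
   is the product one *)
Definition triple w x xm : 'rV[R]_(n + (n + n)) := row_mx w (row_mx x xm).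

Definition potential3 f g h gamma beta c xi (z : 'rV[R]_(n + (n + n))) : \bar R :=
  potential f g h gamma beta c xi
    (lsubmx z) (lsubmx (rsubmx z)) (rsubmx (rsubmx z)).

(* x^{k-1} for k >= 0, where xm1 = x^{-1} *)
Definition previous xm1 (x : nat -> V) (k : nat) : V :=
  if k is j.+1 then x j else xm1.

Definition limit_points xm1 (x : nat -> V) : set 'rV[R]_(n + (n + n)) :=
  cluster (triple (x k.+1) (x k) (previous xm1 x k) @[k --> \oo]).

Definition enlargement (m : nat) (A : set 'rV[R]_m) (r : R) : set 'rV[R]_m :=
  [set z | (dist_set z A < r%:E)%E].

End Algorithm.

(* Main.v *)
Require Import Defs.
From HB Require Import structures.
From mathcomp Require Import all_boot all_order all_algebra.
From mathcomp Require Import ring lra.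
From mathcomp Require Import all_classical all_reals all_analysis.

Set Implicit Arguments.
Unset Strict Implicit.
Unset Printing Implicit Defensive.

Import Order.TTheory GRing.Theory Num.Theory.
Import numFieldNormedType.Exports.
Import DualAddTheory.

Local Open Scope classical_set_scope.
Local Open Scope ring_scope.

(** Write [Phi] for the envelope and [D_psi] for Bregman distances.  The function
    [A_k = Phi (x_k, x_(k-1)) + D_xi (x_k, x_(k-1))] is a Lyapunov function: the
    next model evaluated at its own centre is [phi x_(k+1)], and the three-point
    identity (first family of parameters) or Young's inequality with strong
    convexity (second family) gives
    [phi x_(k+1) + D_xi (x_(k+1), x_k) <= A_k - m D_h (x_(k+1), x_k)] with [m > 0]
    ([admissible_descent]).  The merit function is [A_k] plus a positive multiple
    of [D_h (x_k, x_(k-1))].  For the second family [m = c / (s gamma)] with [s]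
    the strong convexity modulus of [h], so that this estimate yields no decrease
    of the merit function when [s > 2]; the argument therefore runs on [A_k].
    Level boundedness keeps the iterates in a ball, on which the gradients are
    Lipschitz and [D_h] dominates the squared Euclidean distance, because the
    Hessian of [h] is positive definite on a compact set
    ([bregman_coercive_on_ball]).  Hence with [d_k = |x_k - x_(k-1)|] the Lyapunov
    function decreases by at least [rho d_(k+1)^2].

    Since [x_(k+1)] minimizes the model, the gradient of the smooth remainder of
    the potential [F] is a subgradient of [F] at [(x_(k+1), x_k, x_(k-1))], and a
    local Lipschitz estimate bounds it by [K (d_(k+1) + d_k)]
    ([small_subgradient]).  At these points [F] equals the merit function, which
    dominates [A_k].  A concave desingularizing function has a nonincreasing left
    derivative, so the Kurdyka-Lojasiewicz inequality for the merit gap also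
    controls [psi (a_k) - psi (a_(k+1))], where [a_k] is the gap of [A_k]; this
    yields [d_(k+1) <= W_k - W_(k+1)] for a multiple of [psi (a_k)] plus [d_k / 2]
    as [W_k] ([kl_length_step]).  Telescoping, the iterates converge and their
    distance to the limit is at most [W_k] ([kl_convergence]).  The setwise
    property gives the convergence, as the iterates eventually enter every
    enlargement of the set of limit points, and the pointwise property at the
    limit can then be applied with a power function.

    For [psi t = kappa t^(1 - theta)] the same inequality reads
    [e^theta <= K (d_(k+1) + d_k)] for the merit gap [e].  If [theta = 0] the gap
    must vanish once the steps are small.  Otherwise squaring it and using the
    descent twice gives [a_(k+2)^(2 theta) <= K' (a_k - a_(k+2))], which implies
    geometric decay when [2 theta <= 1] ([linear_rate]) and decay like
    [k^(-1 / (2 theta - 1))] when [2 theta > 1] ([sublinear_rate]).  The bound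
    [W_k] transfers these rates to the iterates. *)

(** * Euclidean norm on row vectors *)

Section EuclideanNorm.
Context {R : realType} {m : nat}.
Implicit Types (u v w x y : 'rV[R]_m) (a : R).

Lemma dotC u v : dot u v = dot v u.
Proof. by apply: eq_bigr => i _; rewrite mulrC. Qed.

Lemma dotDl u v w : dot (u + v) w = dot u w + dot v w.
Proof. by rewrite -big_split; apply: eq_bigr => i _; rewrite mxE mulrDl. Qed.

Lemma dotZl a u v : dot (a *: u) v = a * dot u v.
Proof. by rewrite [RHS]mulr_sumr; apply: eq_bigr => i _; rewrite mxE mulrA. Qed.

Lemma dotDr u v w : dot u (v + w) = dot u v + dot u w.
Proof. by rewrite dotC dotDl !(dotC u). Qed.

Lemma dotZr a u v : dot u (a *: v) = a * dot u v.
Proof. by rewrite dotC dotZl dotC. Qed.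

Lemma dotNl u v : dot (- u) v = - dot u v.
Proof. by rewrite -scaleN1r dotZl mulN1r. Qed.

Lemma dotNr u v : dot u (- v) = - dot u v.
Proof. by rewrite dotC dotNl dotC. Qed.

Lemma dotBl u v w : dot (u - v) w = dot u w - dot v w.
Proof. by rewrite dotDl dotNl. Qed.

Lemma dotBr u v w : dot u (v - w) = dot u v - dot u w.
Proof. by rewrite dotDr dotNr. Qed.

Lemma dot0l u : dot 0 u = 0.
Proof. by rewrite -(scale0r 0) dotZl mul0r. Qed.

Lemma dot0r u : dot u 0 = 0.
Proof. by rewrite dotC dot0l. Qed.

Lemma dot_ge0 u : 0 <= dot u u.
Proof. by apply: sumr_ge0 => i _; rewrite -expr2 sqr_ge0. Qed.

Lemma enorm_ge0 u : 0 <= enorm u.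
Proof. exact: sqrtr_ge0. Qed.

Lemma enorm_sqr u : enorm u ^+ 2 = dot u u.
Proof. exact: sqr_sqrtr (dot_ge0 u). Qed.

Lemma dot_eq0 u : dot u u = 0 -> u = 0.
Proof.
move/eqP; rewrite psumr_eq0 => [/allP u0|i _]; last by rewrite -expr2 sqr_ge0.
apply/rowP => i; rewrite mxE; apply/eqP.
by have := u0 i (mem_index_enum i); rewrite mulf_eq0 orbb.
Qed.

Lemma enorm_eq0 u : enorm u = 0 -> u = 0.
Proof. by move=> u0; apply: dot_eq0; rewrite -enorm_sqr u0 expr0n. Qed.

Lemma enorm0 : enorm (0 : 'rV[R]_m) = 0.
Proof. by rewrite /enorm dot0l sqrtr0. Qed.

Lemma enormZ a u : enorm (a *: u) = `|a| * enorm u.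
Proof.
by rewrite /enorm dotZl dotZr mulrA -expr2 sqrtrM ?sqr_ge0// sqrtr_sqr.
Qed.

Lemma enormN u : enorm (- u) = enorm u.
Proof. by rewrite -scaleN1r enormZ normrN1 mul1r. Qed.

Lemma enormB u v : enorm (u - v) = enorm (v - u).
Proof. by rewrite -enormN opprB. Qed.

(** Cauchy-Schwarz, from expanding the square of [|v| u - |u| v]. *)
Lemma dot_le_enorm u v : dot u v <= enorm u * enorm v.
Proof.
have [u0|u0] := eqVneq (enorm u) 0.
  by rewrite (enorm_eq0 u0) dot0l enorm0 mul0r.
have [v0|v0] := eqVneq (enorm v) 0.
  by rewrite (enorm_eq0 v0) dot0r enorm0 mulr0.
have := dot_ge0 (enorm v *: u - enorm u *: v).
rewrite !(dotBl, dotBr, dotZl, dotZr) -!enorm_sqr (dotC v u).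
have pu : 0 < enorm u by rewrite lt_neqAle eq_sym u0 enorm_ge0.
have pv : 0 < enorm v by rewrite lt_neqAle eq_sym v0 enorm_ge0.
have puv : 0 < enorm u * enorm v by rewrite mulr_gt0.
by move=> H; rewrite -(ler_pM2l puv); nra.
Qed.

Lemma dot_norm_le u v : `|dot u v| <= enorm u * enorm v.
Proof.
rewrite ler_norml dot_le_enorm andbT lerNl -dotNl -(enormN u).
exact: dot_le_enorm.
Qed.

Lemma enormD u v : enorm (u + v) <= enorm u + enorm v.
Proof.
rewrite -(@ler_pXn2r _ 2%N) ?nnegrE ?addr_ge0 ?enorm_ge0//.
rewrite enorm_sqr !(dotDl, dotDr) (dotC v u) sqrrD !enorm_sqr.
by have := dot_le_enorm u v; lra.
Qed.

Lemma enorm_dist_triangle w u v : enorm (u - v) <= enorm (u - w) + enorm (w - v).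
Proof. by rewrite -[u - v](subrKA w) enormD. Qed.

Lemma normr_le_enorm u : `|u| <= enorm u.
Proof.
change (mx_norm u <= enorm u); rewrite mx_normrE.
apply/bigmax_leP; split; first exact: enorm_ge0.
move=> [i j] _ /=; rewrite (ord1 i) -sqrtr_sqr; apply: ler_wsqrtr.
rewrite /dot (bigD1 j)//= expr2 lerDl.
by apply: sumr_ge0 => k _; rewrite -expr2 sqr_ge0.
Qed.

Lemma coord_le_normr u i : `|u 0 i| <= `|u|.
Proof.
change (`|u 0 i| <= mx_norm u); rewrite mx_normrE.
exact: (le_bigmax _ (fun ij => `|u ij.1 ij.2|) (0, i)).
Qed.

Lemma enorm_le_normr u : enorm u <= m%:R * `|u|.
Proof.
have dm : dot u u <= m%:R * `|u| ^+ 2.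
  have <- : \sum_(i < m) `|u| ^+ 2 = m%:R * `|u| ^+ 2.
    by rewrite sumr_const card_ord mulr_natl.
  apply: ler_sum => i _; rewrite -expr2 -real_normK ?num_real//.
  by rewrite ler_pXn2r ?nnegrE// coord_le_normr.
rewrite -(@ler_pXn2r _ 2%N) ?nnegrE ?mulr_ge0 ?enorm_ge0// enorm_sqr.
apply: le_trans dm _; rewrite exprMn ler_wpM2r ?sqr_ge0// -natrX ler_nat.
by case: m => // k; rewrite leq_pmull.
Qed.

(** The sup norm of the library and the Euclidean norm have the same
    neighbourhoods, so that limits can be tested with [enorm]. *)
Lemma nbhs_enormP x (P : set 'rV[R]_m) :
  nbhs x P <-> exists2 d : R, 0 < d & forall y, enorm (y - x) < d -> P y.
Proof.
split.
  move/nbhs_ballP => [d /= d0 dP]; exists d => // y yx; apply: dP.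
  rewrite -ball_normE /= distrC.
  by apply: le_lt_trans yx; exact: normr_le_enorm.
move=> [d d0 dP]; apply/nbhs_ballP.
have m0 : 0 < m%:R + 1 :> R by rewrite ltr_wpDl.
exists (d / (m%:R + 1)) => /=; first by rewrite divr_gt0.
move=> y; rewrite -ball_normE /= distrC => yx; apply: dP.
apply: le_lt_trans (enorm_le_normr _) _.
rewrite ltr_pdivlMr// in yx.
by apply: le_lt_trans yx; rewrite mulrC ler_wpM2l// lerDl.
Qed.

Lemma cvg_enormP (T : Type) (G : set_system T) (FG : Filter G)
    (u : T -> 'rV[R]_m) x :
  u @ G --> x <-> forall e : R, 0 < e -> \forall t \near G, enorm (u t - x) < e.
Proof.
split=> [ux e e0|ux P /nbhs_enormP[d d0 dP]].
  by apply: (ux [set y | enorm (y - x) < e]); apply/nbhs_enormP; exists e.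
by apply: filterS (ux d d0) => t; exact: dP.
Qed.

Lemma bounded_enormP (A : set 'rV[R]_m) :
  bounded_set A <-> exists2 M : R, 0 < M & forall y, A y -> enorm y <= M.
Proof.
split=> [[M0 [_ HM]]|[M M0 AM]].
  have M1 : M0 < `|M0| + 1 by rewrite (le_lt_trans (ler_norm _))// ltrDl.
  have HA : forall y, A y -> `|y| <= `|M0| + 1 by exact: HM.
  have N0 : 0 <= `|M0| + 1 by rewrite addr_ge0.
  exists (m%:R * (`|M0| + 1) + 1); first by rewrite ltr_wpDl// mulr_ge0.
  move=> y Ay; apply: le_trans (enorm_le_normr _) _.
  by apply: ler_wpDr => //; rewrite ler_wpM2l// HA.
exists M; split; first exact: num_real.
move=> N MN y Ay; apply: le_trans (normr_le_enorm _) _.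
exact: le_trans (AM _ Ay) (ltW MN).
Qed.

Lemma enorm_continuous : continuous (@enorm R m).
Proof.
move=> x A /nbhs_ballP[e /= e0 eA]; apply/nbhs_enormP; exists e => // y yx.
apply: eA; rewrite -ball_normE /=; apply: le_lt_trans yx; rewrite ler_norml.
have := enormD (y - x) x; have := enormD (x - y) y.
rewrite !subrK (enormB x y); lra.
Qed.

Lemma enorm_ball_closed (M : R) : closed [set y : 'rV[R]_m | enorm y <= M].
Proof.
apply: (@preimage_closed _ _ (@enorm R m) [set t | t <= M]).
  by move=> y _; exact: enorm_continuous.
exact: closed_le.
Qed.

Lemma enorm_ball_compact (M : R) : compact [set y : 'rV[R]_m | enorm y <= M].
Proof.
apply: bounded_closed_compact; last exact: enorm_ball_closed.
apply/bounded_enormP; exists (`|M| + 1); first by rewrite ltr_wpDl.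
by move=> y /= yM; rewrite (le_trans yM)// (le_trans (ler_norm _))// lerDl.
Qed.

End EuclideanNorm.

(** * Differential calculus for real functions of a row vector *)

Section Gradient.
Context {R : realType} {m : nat}.
Implicit Types (u v w x y : 'rV[R]_m) (psi : 'rV[R]_m -> R).

Definition gradient psi x : 'rV[R]_m := \row_(i < m) 'D_(delta_mx 0 i) psi x.

Lemma grad_EFin psi : grad (EFin \o psi) = gradient psi.
Proof. by []. Qed.

Lemma diff_gradient psi x u :
  differentiable psi x -> 'd psi x u = dot (gradient psi x) u.
Proof.
move=> dx; rewrite {1}(row_sum_delta u) linear_sum /dot.
by apply: eq_bigr => i _; rewrite linearZ /= mxE deriveE// mulrC.
Qed.

Lemma gradient_unique psi x g : differentiable psi x ->
  (forall u, 'D_u psi x = dot g u) -> gradient psi x = g.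
Proof.
move=> dx Dg; apply/rowP => i; rewrite mxE Dg /dot (bigD1 i)//= big1 ?addr0.
  by rewrite mxE !eqxx mulr1.
by move=> j ji; rewrite mxE eqxx (negbTE ji) mulr0.
Qed.

(** Differentiability in epsilon-delta form with Euclidean norms, the form that
    matches the definition of regular subgradients. *)
Lemma differentiable_expansion psi x (e : R) : differentiable psi x -> 0 < e ->
  exists2 d : R, 0 < d & forall y, enorm (y - x) < d ->
    `|psi y - psi x - dot (gradient psi x) (y - x)| <= e * enorm (y - x).
Proof.
move=> dx e0; have /eqaddoP/(_ e e0)/nbhs_enormP[d d0 dP] := diff_locally dx.
exists d => // y yx; have := dP (y - x); rewrite subr0 => /(_ yx) /=.
rewrite !fctE /= subrK -diff_gradient// => H.
rewrite -addrA -opprD; apply: (le_trans H).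
by apply: ler_wpM2l; [exact: ltW | exact: normr_le_enorm].
Qed.

(** The difference quotients of [F] in the direction [u] are those of its
    restriction to the line, so differentiation along lines needs no chain rule. *)
Lemma is_derive_line (W : normedModType R) (F : 'rV[R]_m -> W) y u (t : R) dF :
  is_derive (y + t *: u) u F dF ->
  is_derive t (1 : R) (fun s : R => F (y + s *: u)) dF.
Proof.
have E : (fun h : R => h^-1 *: (((fun s : R => F (y + s *: u)) \o shift t)
             (h *: (1 : R)) - F (y + t *: u))) =
         (fun h : R => h^-1 *: ((F \o shift (y + t *: u)) (h *: u)
             - F (y + t *: u))).
  apply/funext => h /=; congr (_ *: (F _ - _)).
  by rewrite [h *: (1 : R)]mulr1 scalerDl addrCA.
move=> [dF1 dF2]; apply: DeriveDef; first by rewrite /derivable E.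
by rewrite /derive E.
Qed.

Lemma is_derive_line_gradient psi y u (t : R) :
  differentiable psi (y + t *: u) ->
  is_derive t (1 : R) (fun s : R => psi (y + s *: u))
    (dot (gradient psi (y + t *: u)) u).
Proof.
move=> dx; apply: is_derive_line; apply: DeriveDef.
  exact: diff_derivable.
by rewrite deriveE// diff_gradient.
Qed.

End Gradient.

Section UnitInterval.
Context {R : realType}.

Lemma mean_value01 (q dq : R -> R) :
  (forall t : R, is_derive t (1 : R) q (dq t)) ->
  exists2 s : R, 0 <= s <= 1 & q 1 - q 0 = dq s.
Proof.
move=> qd.
have qd' (x : R) : x \in `]0, 1[ -> is_derive x 1 q (dq x) by [].
have qc : {within `[0, 1], continuous q}.
  apply: continuous_subspaceT => t; apply: differentiable_continuous.
  by apply/derivable1_diffP; have [] := qd t.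
have [s s01 ->] := MVT_segment ler01 qd' qc.
by exists s; [move: s01; rewrite in_itv | rewrite subr0 mulr1].
Qed.

End UnitInterval.

Section DifferentiableDot.
Context {R : realType} {V : normedModType R} {p : nat}.

Lemma differentiable_dot (a b : V -> 'rV[R]_p) x :
  differentiable a x -> differentiable b x ->
  differentiable (fun y => dot (a y) (b y)) x.
Proof.
move=> da db.
have -> : (fun y => dot (a y) (b y)) =
    \sum_(i < p) ((fun y => a y 0 i * b y 0 i) : V -> R).
  by apply/funext => y; rewrite fct_sumE.
apply: differentiable_sum => i; apply: differentiableM.
  exact: (@differentiable_comp _ _ _ _ a (fun N : 'rV[R]_p => N 0 i)
            x da (differentiable_coord _ _ _)).
exact: (@differentiable_comp _ _ _ _ b (fun N : 'rV[R]_p => N 0 i)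
          x db (differentiable_coord _ _ _)).
Qed.

End DifferentiableDot.

(** * Functions with a locally Lipschitz, differentiable gradient *)

Section Smooth.
Context {R : realType} {n : nat}.
Local Notation V := 'rV[R]_n.
Implicit Types (psi chi : V -> R) (x y u v : V).

Definition lipschitz_gradient psi (r K : R) : Prop :=
  forall x y, enorm x <= r -> enorm y <= r ->
    enorm (gradient psi x - gradient psi y) <= K * enorm (x - y).

(** The regularity that the proof uses: weaker than twice continuous
    differentiability, but stable under linear combinations and satisfied by
    the quadratic functions without any compactness argument. *)
Definition smooth psi : Prop :=
  [/\ forall x, differentiable psi x,
      forall x, differentiable (gradient psi) x
    & forall r, exists2 K : R, 0 <= K & lipschitz_gradient psi r K].

Definition real_bregman psi x y : R :=
  psi x - psi y - dot (gradient psi y) (x - y).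

Lemma gradient_lincomb psi chi (a b : R) x :
  differentiable psi x -> differentiable chi x ->
  gradient (fun z => a * psi z + b * chi z) x =
    a *: gradient psi x + b *: gradient chi x.
Proof.
move=> dp dc.
have E : (fun z => a * psi z + b * chi z) = (a *: psi + b *: chi).
  by apply/funext => z.
rewrite E; apply: gradient_unique.
  by apply: differentiableD; apply: differentiableZ.
move=> u.
have dp' := @diff_derivable _ _ _ psi x u dp.
have dc' := @diff_derivable _ _ _ chi x u dc.
rewrite (deriveD (@derivableZ _ _ _ psi a x u dp')
  (@derivableZ _ _ _ chi b x u dc')).
rewrite (@deriveZ _ _ _ psi a x u dp') (@deriveZ _ _ _ chi b x u dc').
rewrite (deriveE u dp) (deriveE u dc).
by rewrite (diff_gradient u dp) (diff_gradient u dc) dotDl 2!dotZl.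
Qed.

Lemma smooth_lincomb psi chi (a b : R) : smooth psi -> smooth chi ->
  smooth (fun z => a * psi z + b * chi z).
Proof.
move=> [dp gp lp] [dc gc lc].
have E : gradient (fun z => a * psi z + b * chi z) =
    (a *: gradient psi + b *: gradient chi).
  by apply/funext => x; rewrite gradient_lincomb.
split.
- move=> x.
  have -> : (fun z => a * psi z + b * chi z) = (a *: psi + b *: chi).
    by apply/funext => z.
  by apply: differentiableD; apply: differentiableZ.
- by move=> x; rewrite E; apply: differentiableD; apply: differentiableZ.
move=> r; have [K1 K10 H1] := lp r; have [K2 K20 H2] := lc r.
exists (`|a| * K1 + `|b| * K2); first by rewrite addr_ge0// mulr_ge0.
move=> x y xr yr; rewrite !gradient_lincomb//.
have -> : a *: gradient psi x + b *: gradient chi x -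
   (a *: gradient psi y + b *: gradient chi y) =
   a *: (gradient psi x - gradient psi y) + b *: (gradient chi x - gradient chi y).
  by rewrite !scalerBr opprD addrACA.
apply: (le_trans (enormD _ _)); rewrite 2!enormZ mulrDl -2!mulrA.
apply: lerD.
  by apply: ler_wpM2l; [exact: normr_ge0 | exact: H1].
by apply: ler_wpM2l; [exact: normr_ge0 | exact: H2].
Qed.

Lemma bregman_lincomb psi chi (a b : R) x y : smooth psi -> smooth chi ->
  real_bregman (fun z => a * psi z + b * chi z) x y =
    a * real_bregman psi x y + b * real_bregman chi x y.
Proof.
move=> [dp _ _] [dc _ _].
by rewrite /real_bregman gradient_lincomb// dotDl !dotZl; ring.
Qed.

Lemma real_bregman_self psi y : real_bregman psi y y = 0.
Proof. by rewrite /real_bregman !subrr dot0r subr0. Qed.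

Lemma gradient_halfsq (L : R) x :
  gradient (fun z => L / 2 * enorm z ^+ 2) x = L *: x /\
  differentiable (fun z : V => L / 2 * enorm z ^+ 2) x.
Proof.
have E : (fun z : V => L / 2 * enorm z ^+ 2) =
    (L / 2) *: (fun z : V => dot z z).
  by apply/funext => z; rewrite enorm_sqr.
have dd : differentiable (fun z : V => dot z z) x.
  by apply: (@differentiable_dot R _ n id id); exact: ex_diff.
split; last by rewrite E; apply: differentiableZ.
apply: gradient_unique; first by rewrite E; apply: differentiableZ.
move=> u; rewrite E deriveZ; last exact: diff_derivable.
suff -> : 'D_u (fun z : V => dot z z) x = 2 * dot x u.
  by rewrite dotZl /GRing.scale /=; field.
have := @is_derive_line R n _ (fun z : V => dot z z) x u 0
  ('D_u (fun z => dot z z) x).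
rewrite scale0r addr0 => /(_ (@DeriveDef _ _ _ _ _ _ _ _ erefl)).
have -> : (fun s : R => dot (x + s *: u) (x + s *: u)) =
    (fun s : R => dot x x + s * (2 * dot x u) + s ^+ 2 * dot u u).
  by apply/funext => s; rewrite !(dotDl, dotDr, dotZl, dotZr) (dotC u x); ring.
have [] : is_derive 0 (1 : R)
    (fun s : R => dot x x + s * (2 * dot x u) + s ^+ 2 * dot u u) (2 * dot x u).
  by apply: is_derive_eq; rewrite /GRing.scale /=; ring.
move=> _ Dq /(_ (diff_derivable dd)) Du.
by rewrite -Dq (@derive_val _ _ _ _ _ _ _ Du).
Qed.

Lemma smooth_halfsq (L : R) : smooth (fun z : V => L / 2 * enorm z ^+ 2).
Proof.
have E : gradient (fun z : V => L / 2 * enorm z ^+ 2) = *:%R L.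
  by apply/funext => x; have [] := gradient_halfsq L x.
split=> [x|x|r]; first by have [] := gradient_halfsq L x.
  by rewrite E; exact: ex_diff.
exists `|L|; first exact: normr_ge0.
by move=> x y _ _; rewrite E -scalerBr enormZ.
Qed.

Lemma bregman_halfsq (L : R) x y :
  real_bregman (fun z => L / 2 * enorm z ^+ 2) x y = L / 2 * enorm (x - y) ^+ 2.
Proof.
rewrite /real_bregman; have [-> _] := gradient_halfsq L y.
by rewrite !enorm_sqr !(dotBl, dotBr, dotZl) (dotC y x); field.
Qed.

Lemma enorm_segment x y (s r : R) : 0 <= s <= 1 -> enorm x <= r -> enorm y <= r ->
  enorm (y + s *: (x - y)) <= r.
Proof.
move=> /andP[s0 s1] xr yr.
have -> : y + s *: (x - y) = (1 - s) *: y + s *: x.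
  by rewrite scalerBl scale1r scalerBr addrA addrAC.
apply: (le_trans (enormD _ _)); rewrite 2!enormZ !ger0_norm ?subr_ge0//.
have -> : r = (1 - s) * r + s * r by ring.
by apply: lerD; apply: ler_wpM2l; rewrite ?subr_ge0.
Qed.

Lemma bregman_le psi (r K : R) x y : smooth psi -> 0 <= K ->
  lipschitz_gradient psi r K -> enorm x <= r -> enorm y <= r ->
  `|real_bregman psi x y| <= K * enorm (x - y) ^+ 2.
Proof.
move=> [dp _ _] K0 lip xr yr.
have [s s01 E] :=
  mean_value01 (fun t => is_derive_line_gradient (dp (y + t *: (x - y)))).
rewrite scale1r scale0r addr0 [y + _]addrC subrK in E.
rewrite /real_bregman E -dotBl.
have sr : enorm (y + s *: (x - y)) <= r by exact: enorm_segment.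
apply: (le_trans (dot_norm_le _ _)); rewrite expr2 mulrA.
apply: ler_wpM2r; first exact: enorm_ge0.
apply: (le_trans (lip _ _ sr yr)); apply: ler_wpM2l => //.
rewrite addrAC subrr add0r enormZ; case/andP: s01 => s0 s1.
by rewrite ger0_norm// ler_piMl ?enorm_ge0.
Qed.

Lemma convex_chord psi x y (t : R) : convex_on setT (EFin \o psi) ->
  0 <= t -> t <= 1 -> psi (y + t *: (x - y)) <= psi y + t * (psi x - psi y).
Proof.
move=> cvx t0 t1; have := cvx (Itv01 t0 t1) x y (mem_setT _) (mem_setT _).
rewrite /conv /= /conv /= /unstable.onem.
have -> : t *: x + (1 - t) *: y = y + t *: (x - y).
  by rewrite scalerBl scale1r scalerBr addrCA.
move=> H; apply: (le_trans H).
by rewrite le_eqVlt; apply/orP; left; apply/eqP; rewrite /GRing.scale /=; ring.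
Qed.

(** A smooth convex function lies above its tangents: compare the chord slope
    with the derivative at its left end. *)
Lemma convex_bregman_ge0 psi x y : smooth psi ->
  convex_on setT (EFin \o psi) -> 0 <= real_bregman psi x y.
Proof.
move=> [dp _ _] cvx; apply/ler_addgt0Pl => e e0.
have [xy0|xy0] := eqVneq (enorm (x - y)) 0.
  have /eqP := enorm_eq0 xy0; rewrite subr_eq0 => /eqP ->.
  by rewrite real_bregman_self addr0 ltW.
have pxy : 0 < enorm (x - y) by rewrite lt_neqAle eq_sym xy0 enorm_ge0.
have e1 : 0 < e / enorm (x - y) by rewrite divr_gt0.
have [d d0 dP] := differentiable_expansion (dp y) e1.
pose t := Num.min 1 (d / 2 / enorm (x - y)).
have t0 : 0 < t by rewrite lt_min ltr01 /= !divr_gt0.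
have t1 : t <= 1 by rewrite ge_min lexx.
have td : enorm (y + t *: (x - y) - y) < d.
  rewrite addrAC subrr add0r enormZ (ger0_norm (ltW t0)).
  rewrite -ltr_pdivlMr// gt_min; apply/orP; right.
  by rewrite ltr_pM2r ?invr_gt0// ltr_pdivrMr// ltr_pMr// ltr1n.
have := dP _ td; have := convex_chord x y cvx (ltW t0) t1.
rewrite [y + _ - y]addrAC subrr add0r enormZ (ger0_norm (ltW t0)).
rewrite dotZr ler_norml /real_bregman => H1 /andP[H2 _].
have E : e / enorm (x - y) * (t * enorm (x - y)) = t * e.
  by field; rewrite gt_eqF.
rewrite E in H2; rewrite -(ler_pM2l t0); lra.
Qed.

(** Along the segment from [y] to [x], strong monotonicity makes the function
    [psi] minus its tangent minus the quadratic nondecreasing.  A single use of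
    the mean value theorem would not do, since the intermediate point may be
    arbitrarily close to [y]; hence the auxiliary function [q]. *)
Lemma bregman_ge psi (r mu : R) x y : smooth psi ->
  (forall a b, enorm a <= r -> enorm b <= r ->
     mu * enorm (a - b) ^+ 2 <= dot (gradient psi a - gradient psi b) (a - b)) ->
  enorm x <= r -> enorm y <= r ->
  mu / 2 * enorm (x - y) ^+ 2 <= real_bregman psi x y.
Proof.
move=> [dp _ _] mono xr yr; set u := x - y.
pose q t := psi (y + t *: u) - t * dot (gradient psi y) u -
            t ^+ 2 * (mu / 2 * enorm u ^+ 2).
have [s s01] : exists2 s : R, 0 <= s <= 1 & q 1 - q 0 =
    dot (gradient psi (y + s *: u)) u - dot (gradient psi y) u -
      s * (mu * enorm u ^+ 2).
  apply: mean_value01 => t.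
  have dt := is_derive_line_gradient (dp (y + t *: u)).
  rewrite /q; apply: is_derive_eq; rewrite /GRing.scale /=; by field.
have sr : enorm (y + s *: u) <= r by exact: enorm_segment.
have := mono _ _ sr yr.
rewrite /q scale1r scale0r addr0 [y + u]addrC subrK [y + _ - y]addrAC subrr add0r.
rewrite enormZ exprMn real_normK ?num_real// dotZr dotBl /real_bregman -/u.
case/andP: s01; rewrite le_eqVlt => /predU1P[<- _ _ E|s0 _ H E].
  by move: E; rewrite scale0r addr0; lra.
have {}H : s * (mu * enorm u ^+ 2) <=
    dot (gradient psi (y + s *: u)) u - dot (gradient psi y) u.
  by rewrite -(ler_pM2l s0); apply: le_trans H; lra.
lra.
Qed.

End Smooth.

(** * Uniform bounds on the Hessian over balls *)

Section HessianBounds.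
Context {R : realType} {n : nat}.
Local Notation V := 'rV[R]_n.
Implicit Types (psi : V -> R) (x y u v w : V) (H : V -> 'M[R]_n).

Lemma is_derive_dot_line (G : V -> V) y u w (t : R) :
  differentiable G (y + t *: u) ->
  is_derive t (1 : R) (fun s : R => dot (G (y + s *: u)) w)
    (dot (u *m 'J G (y + t *: u)) w).
Proof.
set z := y + t *: u => dG.
apply: (@is_derive_line R n _ (fun z => dot (G z) w)); rewrite -/z.
have cw : continuous (fun v : V => dot v w).
  move=> v; apply: differentiable_continuous.
  by apply: (@differentiable_dot R _ n id (cst w)); exact: ex_diff.
have cv : (h^-1 *: (((fun z => dot (G z) w) \o shift z) (h *: u) - dot (G z) w))
    @[h --> (0:R)^'] --> dot ('D_u G z) w.
  have E : (fun h : R => h^-1 *: (((fun z => dot (G z) w) \o shift z) (h *: u)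
      - dot (G z) w)) =
    (fun v => dot v w) \o (fun h : R => h^-1 *: ((G \o shift z) (h *: u) - G z)).
    by apply/funext => h /=; rewrite dotZl dotBl.
  have cG : h^-1 *: ((G \o shift z) (h *: u) - G z) @[h --> (0:R)^'] --> 'D_u G z.
    exact: (@diff_derivable _ _ _ G z u dG).
  by rewrite E; apply: (cvg_comp _ _ cG); exact: cw.
rewrite -deriveEjacobian//.
by apply: DeriveDef; [exact: cvgP cv | exact: cvg_lim cv].
Qed.

Lemma continuous_mulmx_coord H (j : 'I_n) : continuous H ->
  continuous (fun p : V * V => (p.2 *m H p.1) 0 j).
Proof.
move=> Hc.
have -> : (fun p : V * V => (p.2 *m H p.1) 0 j) =
    (fun p => \sum_(i < n) p.2 0 i * H p.1 i j).
  by apply/funext => p; rewrite mxE.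
apply: continuous_big => [|i _ p]; first exact: add_continuous.
apply: cvgM.
  apply: (@cvg_comp _ _ _ (fun p : V * V => p.2) (fun N : V => N 0 i)).
    exact: cvg_snd.
  exact: coord_continuous.
apply: (@cvg_comp _ _ _ (fun p : V * V => H p.1) (fun N : 'M[R]_n => N i j)).
  apply: (@cvg_comp _ _ _ (fun p : V * V => p.1) H); first exact: cvg_fst.
  exact: Hc.
exact: coord_continuous.
Qed.

Lemma continuous_dot_pair (a b : V * V -> V) :
  (forall j, continuous (fun p => a p 0 j)) ->
  (forall j, continuous (fun p => b p 0 j)) ->
  continuous (fun p => dot (a p) (b p)).
Proof.
move=> ac bc; apply: continuous_big => [|i _ p]; first exact: add_continuous.
by apply: cvgM; [exact: ac | exact: bc].
Qed.

(** The norm of [u *m H x] is a continuous function of the pair [(x, u)]; its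
    maximum over a ball times the unit ball extends to all [u] by homogeneity. *)
Lemma mulmx_bounded_on_ball H (r : R) : continuous H ->
  exists2 K : R, 0 <= K & forall x u, enorm x <= r ->
    enorm (u *m H x) <= K * enorm u.
Proof.
move=> Hc; have [r0|r0] := ltP r 0.
  exists 0 => // x u xr; have := le_lt_trans xr r0.
  by rewrite ltNge enorm_ge0.
pose A := [set y : V | enorm y <= r] `*` [set y : V | enorm y <= 1].
have Ac : compact A by apply: compact_setX; exact: enorm_ball_compact.
have A0 : A !=set0 by exists (0, 0); split; rewrite /= enorm0.
pose q (p : V * V) := dot (p.2 *m H p.1) (p.2 *m H p.1).
have qc : {within A, continuous q}.
  apply: continuous_subspaceT; apply: continuous_dot_pair => j;
  exact: continuous_mulmx_coord.
have [c _ cmax] := compact_EVT_max A0 Ac qc.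
exists (Num.sqrt (q c)); first exact: sqrtr_ge0.
move=> x u xr; have [u0|u0] := eqVneq (enorm u) 0.
  by rewrite (enorm_eq0 u0) mul0mx enorm0 mulr0.
have pu : 0 < enorm u by rewrite lt_neqAle eq_sym u0 enorm_ge0.
have : q (x, (enorm u)^-1 *: u) <= q c.
  apply: cmax; rewrite inE; split => //=.
  by rewrite enormZ ger0_norm ?invr_ge0 ?enorm_ge0// mulVf.
move=> /ler_wsqrtr; rewrite {1}/q /= -/(enorm _) -scalemxAl enormZ.
rewrite ger0_norm ?invr_ge0 ?enorm_ge0// => le1.
by rewrite -ler_pdivrMr// mulrC.
Qed.

(** The minimum of the quadratic form over a ball times the unit sphere is
    attained, hence positive.  The sphere is empty in dimension 0. *)
Lemma pos_def_coercive_on_ball H (r : R) : continuous H ->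
  (forall x, pos_def (H x)) ->
  exists2 mu : R, 0 < mu & forall x u, enorm x <= r ->
    mu * enorm u ^+ 2 <= dot (u *m H x) u.
Proof.
move=> Hc Hp; have [r0|r0] := ltP r 0.
  exists 1 => // x u xr; have := le_lt_trans xr r0.
  by rewrite ltNge enorm_ge0.
pose S := [set y : V | enorm y = 1].
have [S0|/set0P/negP/negPn/eqP S0] := pselect (S !=set0); last first.
  exists 1 => // x u _; have [u0|u0] := eqVneq (enorm u) 0.
    by rewrite (enorm_eq0 u0) mul0mx enorm0 dot0l expr0n mulr0.
  suff : S ((enorm u)^-1 *: u) by rewrite S0.
  by rewrite /S /= enormZ ger0_norm ?invr_ge0 ?enorm_ge0// mulVf.
pose A := [set y : V | enorm y <= r] `*` S.
have Sc : compact S.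
  apply: (@subclosed_compact _ _ [set y : V | enorm y <= 1]).
  - have -> : S = [set y : V | enorm y <= 1] `&` [set y : V | 1 <= enorm y].
      apply/seteqP; split=> y /=; first by move=> ->.
      by move=> [a b]; apply/eqP; rewrite eq_le a.
    apply: closedI; first exact: enorm_ball_closed.
    apply: (@preimage_closed _ _ (@enorm R n) [set t | 1 <= t]).
      by move=> y _; exact: enorm_continuous.
    exact: closed_ge.
  - exact: enorm_ball_compact.
  - by move=> y /= ->.
have Ac : compact A by apply: compact_setX => //; exact: enorm_ball_compact.
have A0 : A !=set0.
  by case: S0 => y Sy; exists (0, y); split => //=; rewrite enorm0.
pose q (p : V * V) := dot (p.2 *m H p.1) p.2.
have qc : {within A, continuous q}.
  apply: continuous_subspaceT; apply: continuous_dot_pair => j.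
    exact: continuous_mulmx_coord.
  move=> p; apply: (@cvg_comp _ _ _ (fun p : V * V => p.2) (fun N : V => N 0 j)).
    exact: cvg_snd.
  exact: coord_continuous.
have [c] := compact_EVT_min A0 Ac qc; rewrite inE => -[_ Sc2] cmin.
exists (q c).
  apply: Hp; apply/eqP => c0; move: Sc2; rewrite /S /= c0 enorm0 => /eqP.
  by rewrite eq_sym oner_eq0.
move=> x u xr; have [u0|u0] := eqVneq (enorm u) 0.
  by rewrite (enorm_eq0 u0) mul0mx enorm0 dot0l expr0n mulr0.
have pu : 0 < enorm u by rewrite lt_neqAle eq_sym u0 enorm_ge0.
have : q c <= q (x, (enorm u)^-1 *: u).
  apply: cmin; rewrite inE; split => //=.
  by rewrite /S /= enormZ ger0_norm ?invr_ge0 ?enorm_ge0// mulVf.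
rewrite {2}/q /= -scalemxAl dotZl dotZr mulrA -expr2 exprVn mulrC => le1.
by rewrite -ler_pdivlMr// exprn_gt0.
Qed.

(** Mean value theorem for the component of the gradient along [w], the
    difference of the two gradients itself, which gives [|w| ^ 2] on the left. *)
Lemma twice_cont_diff_smooth psi : twice_cont_diff (EFin \o psi) -> smooth psi.
Proof.
move=> [d1 d2 hc]; split=> [x|x|r]; [exact: d1|exact: d2|].
have [K K0 HK] := mulmx_bounded_on_ball r hc; exists K => // x y xr yr.
set G := gradient psi; set u := x - y; set w := G x - G y.
have [s s01 E] := mean_value01 (fun t => is_derive_dot_line w (d2 (y + t *: u))).
rewrite scale1r scale0r addr0 [y + u]addrC subrK -dotBl -/w -enorm_sqr in E.
have [w0|w0] := eqVneq (enorm w) 0; first by rewrite w0 mulr_ge0// enorm_ge0.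
have pw : 0 < enorm w by rewrite lt_neqAle eq_sym w0 enorm_ge0.
rewrite -(ler_pM2r pw) -expr2 E; apply: (le_trans (dot_le_enorm _ _)).
rewrite ler_pM2r//; apply: HK.
exact: enorm_segment.
Qed.

(** Strict positivity of the Hessian is uniform on balls by compactness, so that
    there the Bregman distance dominates the squared Euclidean distance. *)
Lemma bregman_coercive_on_ball psi (r : R) : twice_cont_diff (EFin \o psi) ->
  (forall x, pos_def (hess (EFin \o psi) x)) ->
  exists2 mu : R, 0 < mu & forall x y, enorm x <= r -> enorm y <= r ->
    mu * enorm (x - y) ^+ 2 <= real_bregman psi x y.
Proof.
move=> C2 Hp; have [d1 d2 hc] := C2.
have [mu mu0 Hmu] := pos_def_coercive_on_ball r hc Hp.
exists (mu / 2); first by rewrite divr_gt0.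
move=> x y xr yr; apply: (bregman_ge (twice_cont_diff_smooth C2) _ xr yr).
move=> a b ar br; set u := a - b.
have [s s01 E] := mean_value01 (fun t => is_derive_dot_line u (d2 (b + t *: u))).
rewrite scale1r scale0r addr0 [b + u]addrC subrK -dotBl in E.
rewrite E; apply: Hmu.
exact: enorm_segment.
Qed.

End HessianBounds.

(** * Concave desingularizing functions *)

Section Desingularization.
Context {R : realType}.
Implicit Types (eta : \bar R) (psi : R -> R) (s t u : R).

Lemma desing_dom_le eta s t : 0 <= s -> s <= t -> desing_dom eta t ->
  desing_dom eta s.
Proof.
by move=> s0 st [_ te]; split=> //; apply: le_lt_trans te; rewrite lee_fin.
Qed.

Lemma desing_mono eta psi s t : concave_desing eta psi ->
  desing_dom eta t -> 0 <= s -> s <= t -> psi s <= psi t.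
Proof.
move=> [[_ _ _ mono] _] dt s0; rewrite le_eqVlt => /predU1P[->//|st].
by apply/ltW/mono => //; apply: desing_dom_le dt => //; exact: ltW.
Qed.

Lemma desing_three_chords eta psi s t u : concave_desing eta psi ->
  desing_dom eta u -> 0 <= s -> s < t -> t < u ->
  (psi u - psi t) * (t - s) <= (psi t - psi s) * (u - t).
Proof.
move=> [_ cvx] du s0 st tu.
have us : 0 < u - s by rewrite subr_gt0 (lt_trans st).
have tau0 : 0 <= (u - t) / (u - s) by rewrite divr_ge0 ?subr_ge0 ?ltW// (lt_trans st).
have tau1 : (u - t) / (u - s) <= 1.
  by rewrite ler_pdivrMr// mul1r lerB// ltW.
have ds : desing_dom eta s by apply: desing_dom_le du => //; rewrite ltW// (lt_trans st).
have := cvx (Itv01 tau0 tau1) s u (mem_set ds) (mem_set du).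
rewrite /conv /= /conv /= /unstable.onem.
have -> : (u - t) / (u - s) *: (s : R^o) + (1 - (u - t) / (u - s)) *: (u : R^o) = t.
  by rewrite /GRing.scale /=; field; rewrite gt_eqF.
rewrite /GRing.scale /= => H.
have {}H : (u - s) * (- psi t) <= (u - t) * (- psi s) + (t - s) * (- psi u).
  move: H; rewrite -(ler_pM2l us) => H; apply: le_trans H _.
  by rewrite le_eqVlt; apply/orP; left; apply/eqP; field; rewrite gt_eqF.
lra.
Qed.

(** The left derivative of a concave function at [u] is the infimum of the slopes
    of the chords ending at [u], hence a lower bound for every chord slope to
    the left of [u]. *)
Lemma left_derivative_chord eta psi u : concave_desing eta psi ->
  desing_dom eta u -> 0 < u ->
  0 <= left_derivative psi u /\
  forall s t, 0 <= s -> s <= t -> t <= u ->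
    left_derivative psi u * (t - s) <= psi t - psi s.
Proof.
move=> cpsi du u0.
pose sl (h : R) := (psi (u + h) - psi u) / h.
have slE h : sl h = (psi u - psi (u + h)) / (- h).
  by rewrite /sl invrN mulrN -mulNr opprB.
have sl_ge0 h : - u <= h -> h < 0 -> 0 <= sl h.
  move=> uh h0; rewrite slE; apply: divr_ge0; last lra.
  by rewrite subr_ge0; apply: (desing_mono cpsi du); lra.
have sl_mono h1 h2 : - u <= h1 -> h1 <= h2 -> h2 < 0 -> sl h2 <= sl h1.
  move=> uh1; rewrite le_eqVlt => /predU1P[->//|h12] h20.
  have := @desing_three_chords eta psi (u + h1) (u + h2) u cpsi du.
  move=> /(_ ltac:(lra) ltac:(lra) ltac:(lra)) H.
  rewrite !slE ler_pdivrMr ?oppr_gt0// mulrAC ler_pdivlMr ?oppr_gt0; last lra.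
  lra.
have near0 : \forall h \near (0:R)^'-, - u <= h /\ h < 0.
  by near=> h; split; near: h; [apply: nbhs_left_ge; lra | exact: nbhs_left_lt].
have cvgsl : cvg (sl h @[h --> (0:R)^'-]).
  rewrite -is_cvgNE; apply: nondecreasing_at_left_is_cvgr.
    apply: filterS near0 => x [ux _] h1 h2.
    rewrite !in_itv /= => /andP[x1 h10] /andP[x2 h20] h12.
    by rewrite lerN2; apply: sl_mono => //; exact: le_trans (ltW x1).
  apply: filterS near0 => x [ux _]; exists 0 => y [h /=].
  rewrite in_itv /= => /andP[xh h0] <-.
  by rewrite oppr_le0; apply: sl_ge0 => //; exact: le_trans (ltW xh).
have ld_ge0 : 0 <= left_derivative psi u.
  by apply: limr_ge => //; apply: filterS near0 => h [? ?]; exact: sl_ge0.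
have ld_le h : - u <= h -> h < 0 -> left_derivative psi u <= sl h.
  move=> uh h0; apply: limr_le => //.
  have : \forall k \near (0:R)^'-, h <= k by apply: nbhs_left_ge.
  by apply: filterS2 near0 => k [_ k0] hk; exact: sl_mono.
split=> // s t s0; rewrite le_eqVlt => /predU1P[->|st tu].
  by rewrite !subrr mulr0.
have := ld_le (s - u) ltac:(lra) ltac:(lra).
rewrite slE [u + (s - u)]addrC subrK opprB ler_pdivlMr ?subr_gt0; last lra.
move: tu; rewrite le_eqVlt => /predU1P[->//|tu].
have := desing_three_chords cpsi du s0 st tu.
set L := left_derivative psi u => H1 H2.
have {}H2 : L * (u - s) * (t - s) <= (psi t - psi s) * (u - s).
  apply: (@le_trans _ _ ((psi u - psi s) * (t - s))); last by nra.
  by rewrite ler_wpM2r// subr_ge0 ltW.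
have us : 0 < u - s by lra.
by rewrite -(ler_pM2r us); lra.
Unshelve. all: by end_near. Qed.

End Desingularization.

(** * Finite length from the Kurdyka-Lojasiewicz inequality *)

Section FiniteLength.
Context {R : realType}.

(** One step of the length estimate.  With [X = K / rho * (psi a - psi a')] the
    descent and the slope inequality give [d' ^ 2 <= X (d' + d)], and
    [4 X (d' - X) <= d' ^ 2] turns this into [3 d' <= 4 X + d]. *)
Lemma kl_length_step eta psi (rho K a a' e d d' : R) :
  concave_desing eta psi -> 0 < rho -> 0 < K -> 0 <= d -> 0 <= d' ->
  0 <= a' -> a' + rho * d' ^+ 2 <= a -> a <= e -> (e%:E < eta)%E ->
  (0 < e -> 1 <= left_derivative psi e * (K * (d' + d))) ->
  d' <= (2 * K / rho * psi a + d / 2) - (2 * K / rho * psi a' + d' / 2).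
Proof.
move=> cpsi rho0 K0 d0 d'0 a'0 desc ae eeta kl.
have dd : 0 <= rho * d' ^+ 2 by apply: mulr_ge0; [exact: ltW|exact: sqr_ge0].
have aa' : a' <= a by lra.
have a0 : 0 <= a by lra.
have de : desing_dom eta e by split=> //; lra.
have da := desing_dom_le a0 ae de.
have psimono := desing_mono cpsi da a'0 aa'.
set X := K / rho * (psi a - psi a').
have X0 : 0 <= X by apply: mulr_ge0; [exact: divr_ge0 (ltW _) (ltW _)|rewrite subr_ge0].
have -> : 2 * K / rho * psi a + d / 2 - (2 * K / rho * psi a' + d' / 2) =
   2 * X + (d - d') / 2 by rewrite /X; field; rewrite gt_eqF.
(* For [e <= 0] all gaps vanish and the descent inequality gives [d' = 0]. *)
have key : d' ^+ 2 <= X * (d' + d).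
  have [e0|e0] := leP e 0.
    have d'2 : rho * d' ^+ 2 <= 0 by lra.
    rewrite pmulr_rle0// in d'2; apply: le_trans d'2 _.
    by rewrite mulr_ge0// addr_ge0.
  have [ld0 ld] := left_derivative_chord cpsi de e0.
  have := ld _ _ a'0 aa' ae; have := kl e0.
  set L := left_derivative psi e => H1 H2.
  have H3 : rho * d' ^+ 2 <= K * (psi a - psi a') * (d' + d).
    apply: (@le_trans _ _ ((a - a') * 1)); first lra.
    apply: (@le_trans _ _ ((a - a') * (L * (K * (d' + d))))).
      by rewrite ler_wpM2l// subr_ge0.
    have Kd : 0 <= K * (d' + d) by rewrite mulr_ge0 ?addr_ge0// ltW.
    have := ler_wpM2r Kd H2; lra.
  by rewrite -(ler_pM2l rho0); apply: le_trans H3 _; rewrite /X le_eqVlt;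
     apply/orP; left; apply/eqP; field; rewrite gt_eqF.
rewrite leNgt; apply/negP => H.
have H1 : d < 3 * d' - 4 * X by lra.
have [X00|X00] := eqVneq X 0.
  rewrite X00 mul0r in key.
  have : d' <= 0 by rewrite -(@ler_pXn2r _ 2%N) ?nnegrE// expr0n.
  by rewrite X00 in H1; lra.
have Xp : 0 < X by rewrite lt_neqAle eq_sym X00.
have : X * (d' + d) < X * (4 * d' - 4 * X) by rewrite ltr_pM2l//; lra.
have := sqr_ge0 (d' - 2 * X); nra.
Qed.

Lemma telescoping_cvg {n : nat} (x : nat -> 'rV[R]_n) (W : nat -> R) (N : nat) :
  (forall j, (N <= j)%N -> 0 <= W j) ->
  (forall j, (N <= j)%N -> enorm (x j.+1 - x j) <= W j - W j.+1) ->
  cvg (x @ \oo) /\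
  forall j, (N <= j)%N -> enorm (x j - lim (x @ \oo)) <= W j.
Proof.
move=> W0 xW.
have dist i j : (N <= i)%N -> enorm (x (i + j)%N - x i) <= W i - W (i + j)%N.
  move=> Ni; elim: j => [|j IH]; first by rewrite addn0 !subrr enorm0.
  have := enorm_dist_triangle (x (i + j)%N) (x (i + j.+1)%N) (x i).
  have := xW (i + j)%N (leq_trans Ni (leq_addr _ _)); rewrite addnS; lra.
have Wdec i j : (N <= i)%N -> (i <= j)%N -> W j <= W i.
  move=> Ni /subnKC <-; have := dist i (j - i)%N Ni.
  by have := enorm_ge0 (x (i + (j - i))%N - x i); lra.
have cW : cvg (W @ \oo).
  apply: (@near_nonincreasing_is_cvgn _ W 0); last by exists N.
  by exists N => // i Ni j ij; exact: Wdec.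
have cx : cvg (x @ \oo).
  apply: cauchy_cvg; apply/cauchy_exP => e e0.
  have /cvgrPdist_lt /(_ e e0) [i _ ie] := cW.
  exists (x (N + i)%N); exists (N + i)%N => // j /= ij.
  rewrite -ball_normE /=; apply: (le_lt_trans (normr_le_enorm _)).
  have := ie (N + i)%N (leq_addl _ _); have := ie j (leq_trans (leq_addl _ _) ij).
  have := dist (N + i)%N (j - (N + i))%N (leq_addr _ _).
  rewrite subnKC// (enormB (x j)) !ltr_norml => h1 /andP[h2 h3] /andP[h4 h5].
  have Wl : lim (W @ \oo) <= W j.
    apply: limr_le => //; exists j => // k /= jk.
    by apply: Wdec => //; apply: leq_trans ij; exact: leq_addr.
  by lra.
split => // j Nj; apply/ler_addgt0Pl => e e0.
have /cvg_enormP /(_ e e0) := cx.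
case=> i _ ie; have := ie (j + i)%N (leq_addl _ _); rewrite /=.
have := dist j i Nj; have := W0 (j + i)%N (leq_trans Nj (leq_addr _ _)).
have := enorm_dist_triangle (x (j + i)%N) (x j) (lim (x @ \oo)).
rewrite (enormB (x j) (x (j + i)%N)); lra.
Qed.

End FiniteLength.

(** * Rates of convergence *)

Section Rates.
Context {R : realType}.
Implicit Types (a : nat -> R) (s K : R).

Lemma powR_anti_exponent (t r r' : R) : 0 <= t <= 1 -> 0 < r -> r <= r' ->
  t `^ r' <= t `^ r.
Proof.
move=> /andP[t0 t1] r0 rr'; move: t0; rewrite le_eqVlt => /predU1P[<-|t0].
  by rewrite !powR0// gt_eqF// (lt_le_trans r0).
by apply: ger_powR => //; rewrite t0.
Qed.

Lemma two_step_ind (P : nat -> Prop) (N : nat) : P N -> P N.+1 ->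
  (forall j, (N <= j)%N -> P j -> P j.+2) -> forall j, (N <= j)%N -> P j.
Proof.
move=> PN PN1 step.
have H i : P (N + i)%N /\ P (N + i).+1.
  elim: i => [|i [IH1 IH2]]; first by rewrite addn0.
  by rewrite addnS; split=> //; apply: step => //; exact: leq_addr.
by move=> j /subnKC <-; have [] := H (j - N)%N.
Qed.

(** For [s <= 1] and gaps at most 1, [a <= a `^ s], so the recurrence contracts
    by the factor [K / (1 + K)] every two steps. *)
Lemma linear_rate a s K (N : nat) : 0 < s <= 1 -> 0 < K ->
  (forall j, (N <= j)%N -> 0 <= a j <= 1) ->
  (forall j, (N <= j)%N -> a j.+2 `^ s <= K * (a j - a j.+2)) ->
  exists C Q : R, [/\ 0 < C, 0 < Q < 1 &
    forall j, (N <= j)%N -> a j <= C * Q ^+ j].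
Proof.
move=> /andP[s0 s1] K0 a01 rec; pose q := K / (1 + K).
have K1 : 0 < 1 + K by rewrite addr_gt0.
have q0 : 0 < q by rewrite divr_gt0.
have q1 : q < 1 by rewrite ltr_pdivrMr// mul1r ltrDr.
pose Q := Num.sqrt q.
have Q0 : 0 < Q by rewrite sqrtr_gt0.
have Q1 : Q < 1 by rewrite -sqrtr1 ltr_sqrt.
have QQ : Q ^+ 2 = q by rewrite sqr_sqrtr// ltW.
have Qk k : 0 < Q ^+ k by rewrite exprn_gt0.
have [a0N _] := andP (a01 N (leqnn N)).
have [a0N1 _] := andP (a01 N.+1 (leqnSn N)).
pose C := a N / Q ^+ N + a N.+1 / Q ^+ N.+1 + 1.
have C0 : 0 < C by rewrite ltr_wpDl// addr_ge0// divr_ge0// ltW.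
exists C, Q; split; rewrite ?Q0//; apply: two_step_ind.
- rewrite -ler_pdivrMr// /C -addrA lerDl addr_ge0// divr_ge0// ltW//.
- by rewrite -ler_pdivrMr// /C addrAC lerDr addr_ge0// divr_ge0// ltW.
move=> j Nj IH; have [a0 a1] := andP (a01 j.+2 (leqW (leqW Nj))).
have H : a j.+2 <= K * (a j - a j.+2).
  apply: le_trans (rec j Nj); rewrite -{1}(powRr1 a0).
  by apply: powR_anti_exponent; rewrite ?a0.
have {}H : a j.+2 <= q * a j.
  by rewrite /q mulrAC ler_pdivlMr//; lra.
apply: (le_trans H); rewrite -[j.+2]add2n exprD QQ mulrCA.
by rewrite ler_pM2l.
Qed.

(** [t^-p - (t+2)^-p <= p 2^(p+2) (t+2)^-(p+1)]: the decrease of the comparison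
    sequence over two steps, from [ln (1 + z) <= z <= exp z - 1]. *)
Lemma powR_two_step (t p : R) : 2 <= t -> 0 < p ->
  t `^ (- p) - (t + 2) `^ (- p) <=
    p * 2 `^ (p + 2) * (t + 2) `^ (- (p + 1)).
Proof.
move=> t2 p0; set u := t + 2.
have t0 : 0 < t by lra.
have u0 : 0 < u by rewrite /u; lra.
have tp : 0 < t `^ (- p) by rewrite powR_gt0.
have E : u `^ (- p) = t `^ (- p) * (u / t) `^ (- p).
  by rewrite -powRM ?divr_ge0 ?ltW// mulrC divfK ?gt_eqF.
have H1 : 1 - p * (2 / t) <= (u / t) `^ (- p).
  have ut0 : 0 < u / t by rewrite divr_gt0.
  rewrite /powR gt_eqF//; apply: le_trans (expR_ge1Dx _).
  rewrite lerD2l mulNr lerN2 ler_pM2l//.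
  have -> : u / t = 1 + 2 / t by rewrite /u; field; rewrite gt_eqF.
  by apply: le_ln1Dx; apply: lt_trans (_ : 0 < _); rewrite ?divr_gt0//; lra.
have H2 : t `^ (- p) - u `^ (- p) <= 2 * p * (t `^ (- p) / t).
  rewrite E -[X in X - _]mulr1 -mulrBr.
  have -> : 2 * p * (t `^ (- p) / t) = t `^ (- p) * (p * (2 / t)).
    by field; rewrite gt_eqF.
  by rewrite ler_pM2l//; lra.
apply: (le_trans H2).
have -> : t `^ (- p) / t = t `^ (- (p + 1)).
  rewrite opprD powRD; last by rewrite (gt_eqF t0) implybT.
  by rewrite powR_inv1// ltW.
have -> : p * 2 `^ (p + 2) * u `^ (- (p + 1)) =
    2 * p * (2 `^ (p + 1) * u `^ (- (p + 1))).
  have -> : 2 `^ (p + 2) = 2 * 2 `^ (p + 1).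
    have -> : p + 2 = 1 + (p + 1) by ring.
    by rewrite [LHS]powRD ?pnatr_eq0 ?implybT// powRr1.
  by ring.
rewrite ler_pM2l; last by rewrite mulr_gt0.
rewrite !powRN -ler_pdivrMr ?invr_gt0 ?powR_gt0// invrK mulrC.
rewrite ler_pdivrMr ?powR_gt0// -powRM//; last exact: ltW.
apply: ge0_ler_powR; rewrite ?nnegrE; rewrite /u; lra.
Qed.

(** Comparison with [C (j+2)^-p], [p = 1 / (s - 1)]: if the bound failed at [j + 2],
    the recurrence would force the comparison sequence to drop by more than
    [C^s (j+4)^-(p+1) / K], which is excluded as soon as [C^(s-1)] is large. *)
Lemma sublinear_rate a s K (N : nat) : 1 < s -> 0 < K ->
  (forall j, (N <= j)%N -> 0 <= a j) ->
  (forall j, (N <= j)%N -> a j.+2 `^ s <= K * (a j - a j.+2)) ->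
  exists2 C : R, 0 < C &
    forall j, (N <= j)%N -> a j <= C * j.+2%:R `^ (- (s - 1)^-1).
Proof.
move=> s1 K0 a0 rec; set p := (s - 1)^-1.
have s10 : 0 < s - 1 by rewrite subr_gt0.
have p0 : 0 < p by rewrite invr_gt0.
pose M := K * (p * 2 `^ (p + 2)).
have M0 : 0 < M by rewrite !mulr_gt0 ?powR_gt0.
have jp (j : nat) : 0 < j.+2%:R `^ (- p) :> R by rewrite powR_gt0.
pose C := a N / N.+2%:R `^ (- p) + a N.+1 / N.+3%:R `^ (- p) + M `^ p.
have aN : 0 <= a N / N.+2%:R `^ (- p) by rewrite divr_ge0 ?a0// ltW.
have aN1 : 0 <= a N.+1 / N.+3%:R `^ (- p) by rewrite divr_ge0 ?a0 ?leqnSn// ltW.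
have Mp : 0 < M `^ p by rewrite powR_gt0.
have C0 : 0 < C by rewrite /C; lra.
have CM : M <= C `^ (s - 1).
  have {1}-> : M = (M `^ p) `^ (s - 1).
    by rewrite -powRrM mulVf ?gt_eqF// powRr1// ltW.
  have MC : M `^ p <= C by rewrite /C; lra.
  by apply: ge0_ler_powR => //; rewrite ?nnegrE ltW.
exists C => //; apply: two_step_ind.
- by rewrite -ler_pdivrMr// /C; lra.
- by rewrite -ler_pdivrMr// /C; lra.
move=> j Nj IH; rewrite leNgt; apply/negP => H.
set t : R := j.+2%:R in IH; have t2 : 2 <= t by rewrite ler_nat.
have Eu : j.+4%:R = t + 2 :> R by rewrite /t -natrD addn2.
rewrite Eu in H; set u := t + 2 in H.
have u0 : 0 < u by rewrite /u; lra.
have aj2 : 0 <= a j.+2 by apply: a0; rewrite !leqW.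
have H1 : (C * u `^ (- p)) `^ s < a j.+2 `^ s.
  apply: gt0_ltr_powR; rewrite ?nnegrE//; first lra.
  by rewrite mulr_ge0// ?powR_ge0// ltW.
rewrite powRM ?powR_ge0 ?(ltW C0)// -powRrM in H1.
have Eps : - p * s = - (p + 1) by rewrite /p; field; rewrite gt_eqF.
have ECs : C `^ s = C * C `^ (s - 1) by rewrite mulr_powRB1// ?ltW//; lra.
rewrite Eps ECs in H1.
have H2 := powR_two_step t2 p0; rewrite -/u in H2.
have uq : 0 < u `^ (- (p + 1)) by rewrite powR_gt0.
have H3 : K * (a j - a j.+2) <= C * M * u `^ (- (p + 1)).
  have -> : C * M * u `^ (- (p + 1)) =
      K * (C * (p * 2 `^ (p + 2) * u `^ (- (p + 1)))) by rewrite /M; ring.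
  rewrite ler_pM2l//; have := ler_wpM2l (ltW C0) H2; lra.
have H4 : C * M * u `^ (- (p + 1)) <= C * C `^ (s - 1) * u `^ (- (p + 1)).
  by rewrite ler_pM2r// ler_pM2l.
by have := rec j Nj; lra.
Qed.

End Rates.

(** Here [a] is the gap of a Lyapunov function, [e] a larger gap for which the
    Kurdyka-Lojasiewicz inequality is known, and [d] the length of the steps. *)
Section KLRates.
Context {R : realType} {n : nat}.
Variables (x : nat -> 'rV[R]_n) (l : 'rV[R]_n) (a e : nat -> R).
Variables (theta rho B K C : R) (N : nat).
Let d j := enorm (x j.+1 - x j).

Hypotheses (rho0 : 0 < rho) (B0 : 0 < B) (K0 : 0 < K) (C0 : 0 < C).
Hypothesis theta01 : 0 <= theta < 1.
Hypothesis a01 : forall j, (N <= j)%N -> 0 <= a j <= 1.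
Hypothesis desc : forall j, (N <= j)%N -> a j.+1 + rho * d j.+1 ^+ 2 <= a j.
Hypothesis ae : forall j, (N <= j)%N -> a j <= e j.
Hypothesis eB : forall j, (N <= j)%N -> e j.+1 <= B * a j.
Hypothesis kl : forall j, (N <= j)%N -> 0 < e j ->
  e j `^ theta <= K * (d j.+1 + d j).
Hypothesis tail : forall j, (N <= j)%N ->
  enorm (x j.+1 - l) <= C * a j `^ (1 - theta) + d j / 2.

Let d_ge0 j : 0 <= d j. Proof. exact: enorm_ge0. Qed.

Let rd2_ge0 j : 0 <= rho * d j ^+ 2.
Proof. by apply: mulr_ge0; [exact: ltW|exact: sqr_ge0]. Qed.

(** With exponent 0 the inequality bounds the steps away from 0 as long as the
    gap is positive, which is impossible once the steps are small. *)
Lemma kl_finite_termination : theta = 0 -> d @ \oo --> (0 : R) ->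
  (\forall k \near \oo, e k = 0) /\ (\forall k \near \oo, x k = l).
Proof.
move=> th0 d0.
have [M _ dM] : \forall j \near \oo, d j < (2 * K)^-1.
  have K2 : 0 < (2 * K)^-1 by rewrite invr_gt0 mulr_gt0.
  have /cvgrPdist_lt/(_ _ K2) := d0; apply: filterS => j.
  by rewrite sub0r normrN ger0_norm.
pose P := maxn N M.
have e0 j : (P <= j)%N -> e j = 0.
  rewrite geq_max => /andP[Nj Mj]; have [aj _] := andP (a01 Nj).
  apply: le_anti; rewrite (le_trans aj (ae Nj)) andbT leNgt; apply/negP => ej.
  have := kl Nj ej; rewrite th0 powRr0.
  have := dM j Mj; have := dM j.+1 (leqW Mj).
  move=> h1 h2.
  have : K * (d j.+1 + d j) < K * K^-1.
    have -> : K^-1 = (2 * K)^-1 + (2 * K)^-1 by field; rewrite gt_eqF.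
    by rewrite ltr_pM2l// ltrD.
  by rewrite mulfV ?gt_eqF//; lra.
split; first by exists P.
exists P.+2 => // -[|[|j]]//= Pj; have {}Pj : (P <= j)%N by [].
have Nj : (N <= j)%N by apply: leq_trans Pj; exact: leq_maxl.
have aj : a j.+1 = 0.
  apply: le_anti; have [-> _] := andP (a01 (leqW Nj)); rewrite andbT.
  by rewrite -(e0 j.+1 (leqW Pj)) ae// leqW.
have dj : d j.+1 = 0.
  have aj0 : a j <= 0 by rewrite -(e0 j Pj) ae.
  have := desc Nj; rewrite aj add0r => h.
  have : rho * d j.+1 ^+ 2 <= 0 by lra.
  rewrite pmulr_rle0// => h2; apply: le_anti; rewrite d_ge0 andbT.
  by rewrite -(@ler_pXn2r _ 2%N) ?nnegrE// expr0n.
have := tail (leqW Nj); rewrite aj dj mul0r addr0 powR0 ?mulr0; last first.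
  by rewrite th0 subr0 oner_eq0.
move=> h; apply/eqP; rewrite -subr_eq0; apply/eqP/enorm_eq0/le_anti.
by rewrite h enorm_ge0.
Qed.

(** The bound on the subgradients involves two consecutive steps, whose squares
    are controlled by two consecutive decreases of [a]. *)
Let two_step_decrease j : 0 < theta -> (N <= j)%N ->
  a j.+2 `^ (2 * theta) <= 2 * K ^+ 2 / rho * (a j - a j.+2).
Proof.
move=> th0 Nj.
have Nj1 := leqW Nj; have Nj2 := leqW Nj1.
have [aj0 _] := andP (a01 Nj).
have [aj1 _] := andP (a01 Nj1); have [aj2 _] := andP (a01 Nj2).
have h1 := desc Nj; have h2 := desc Nj1.
have := rd2_ge0 j.+1; have := rd2_ge0 j.+2 => g2 g1.
have [e0|e0] := leP (e j.+1) 0.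
  have z : a j.+2 = 0 by have := ae Nj1; lra.
  rewrite z powR0 ?subr0; last by rewrite mulf_neq0// ?pnatr_eq0// gt_eqF.
  by rewrite mulr_ge0// divr_ge0 ?mulr_ge0 ?sqr_ge0// ltW.
apply: (@le_trans _ _ (e j.+1 `^ (2 * theta))).
  by apply: ge0_ler_powR; rewrite ?nnegrE; have := ae Nj1; lra.
rewrite mulrC powRrM (powR_mulrn 2) ?powR_ge0//.
have h3 : (e j.+1 `^ theta) ^+ 2 <= (K * (d j.+2 + d j.+1)) ^+ 2.
  rewrite ler_pXn2r ?nnegrE ?powR_ge0// ?kl//.
  by rewrite mulr_ge0 ?addr_ge0// ltW.
apply: (le_trans h3).
have h4 : rho * (d j.+2 + d j.+1) ^+ 2 <= 2 * (a j - a j.+2).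
  have : (d j.+2 + d j.+1) ^+ 2 <= 2 * (d j.+2 ^+ 2 + d j.+1 ^+ 2).
    by have := sqr_ge0 (d j.+2 - d j.+1); nra.
  by move/(ler_wpM2l (ltW rho0)); lra.
have -> : 2 * K ^+ 2 / rho * (a j - a j.+2) =
  K ^+ 2 / rho * (2 * (a j - a j.+2)) by field; rewrite gt_eqF.
have -> : (K * (d j.+2 + d j.+1)) ^+ 2 =
  K ^+ 2 / rho * (rho * (d j.+2 + d j.+1) ^+ 2) by field; rewrite gt_eqF.
by rewrite ler_pM2l// divr_gt0// exprn_gt0.
Qed.

(** The step is of the order of the square root of the previous gap, so the two
    terms of the tail estimate are powers of gaps with exponents [1 - theta] and
    [1 / 2]; as the gaps are at most 1, both exponents can be lowered to [r]. *)
Let tail_power (r : R) j : 0 < r -> r <= 1 - theta -> r <= 1 / 2 -> (N <= j)%N ->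
  enorm (x j.+2 - l) <= (C + Num.sqrt rho^-1) * a j `^ r.
Proof.
move=> r0 r1 r2 Nj; have Nj1 := leqW Nj.
apply: (le_trans (tail Nj1)).
have [aj0 _] := andP (a01 Nj); have [aj1 _] := andP (a01 Nj1).
have h := desc Nj; have := rd2_ge0 j.+1 => g.
have h1 : a j.+1 `^ (1 - theta) <= a j `^ r.
  apply: (@le_trans _ _ (a j `^ (1 - theta))).
    by apply: ge0_ler_powR; rewrite ?nnegrE; lra.
  by apply: powR_anti_exponent => //; exact: a01.
have h2 : d j.+1 <= Num.sqrt rho^-1 * a j `^ r.
  have : d j.+1 ^+ 2 <= rho^-1 * a j by rewrite mulrC ler_pdivlMr//; lra.
  have ri : 0 <= rho^-1 by rewrite invr_ge0 ltW.
  move/ler_wsqrtr; rewrite sqrtr_sqr ger0_norm// sqrtrM// => h2.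
  apply: (le_trans h2); rewrite ler_wpM2l ?sqrtr_ge0// -powR12_sqrt//.
  by apply: powR_anti_exponent; rewrite ?a01//; lra.
rewrite mulrDl; apply: lerD; first by rewrite ler_pM2l.
by have := d_ge0 j.+1; lra.
Qed.

Lemma kl_linear_convergence : 0 < theta <= 1 / 2 ->
  exists c1 chat1 Q1 Qhat1 : R,
    [/\ 0 < c1, 0 < chat1, 0 <= Q1 < 1, 0 <= Qhat1 < 1
      & \forall k \near \oo,
          e k <= chat1 * Qhat1 ^+ k /\ enorm (x k - l) <= c1 * Q1 ^+ k].
Proof.
move=> /andP[th0 th1].
have s01 : 0 < 2 * theta <= 1 by apply/andP; split; lra.
have K2 : 0 < 2 * K ^+ 2 / rho by rewrite divr_gt0// mulr_gt0// exprn_gt0.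
have [D [Q [D0 /andP[Q0 Q1] aQ]]] :=
  linear_rate s01 K2 a01 (fun j => two_step_decrease th0).
pose S := Num.sqrt Q.
have S0 : 0 < S by rewrite sqrtr_gt0.
have S1 : S < 1 by rewrite -sqrtr1 ltr_sqrt.
have sD : 0 < Num.sqrt D by rewrite sqrtr_gt0.
have Cr : 0 < C + Num.sqrt rho^-1 by rewrite ltr_wpDr// sqrtr_ge0.
exists ((C + Num.sqrt rho^-1) * (Num.sqrt D / S ^+ 2)), (B * (D / Q)), S, Q.
split.
- by rewrite mulr_gt0// divr_gt0// exprn_gt0.
- by rewrite mulr_gt0// divr_gt0.
- by rewrite ltW.
- by rewrite ltW.
exists N.+2 => // -[|[|k]]//= Nk; have {}Nk : (N <= k)%N by [].
split.
  apply: (le_trans (eB (leqW Nk))); rewrite -mulrA ler_pM2l//.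
  apply: (le_trans (aQ _ (leqW Nk))); rewrite -mulrA ler_pM2l//.
  by rewrite [X in _ <= _ * X]exprS mulKf ?gt_eqF.
apply: (le_trans (@tail_power (1 / 2) k _ _ _ Nk)); try lra.
rewrite -mulrA ler_pM2l//.
have -> : Num.sqrt D / S ^+ 2 * S ^+ k.+2 = S ^+ k * Num.sqrt D.
  by rewrite -[k.+2]addn2 exprD; field; rewrite gt_eqF.
have [ak _] := andP (a01 Nk).
rewrite mul1r powR12_sqrt//.
have -> : S ^+ k * Num.sqrt D = Num.sqrt (D * Q ^+ k).
  rewrite sqrtrM; last exact: ltW.
  have -> : Q = S ^+ 2 by rewrite sqr_sqrtr// ltW.
  rewrite -exprM mulnC exprM sqrtr_sqr ger0_norm 1?mulrC//.
  by rewrite exprn_ge0// ltW.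
exact/ler_wsqrtr/aQ.
Qed.

Lemma kl_sublinear_convergence : 1 / 2 < theta ->
  exists c2 chat2 : R, [/\ 0 < c2, 0 < chat2
    & \forall k \near \oo,
        e k <= chat2 * k%:R `^ (- (1 / (2 * theta - 1))) /\
        enorm (x k - l) <= c2 * k%:R `^ (- ((1 - theta) / (2 * theta - 1)))].
Proof.
move=> th12; have /andP[_ th1] := theta01.
have th0 : 0 < theta by lra.
have s1 : 1 < 2 * theta by lra.
have K2 : 0 < 2 * K ^+ 2 / rho by rewrite divr_gt0// mulr_gt0// exprn_gt0.
have a0 j (Nj : (N <= j)%N) : 0 <= a j by have [] := andP (a01 Nj).
have [D D0 aD] := sublinear_rate s1 K2 a0 (fun j => two_step_decrease th0).
set p := (2 * theta - 1)^-1 in aD *.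
have p0 : 0 < p by rewrite invr_gt0; lra.
have Cr : 0 < C + Num.sqrt rho^-1 by rewrite ltr_wpDr// sqrtr_ge0.
exists ((C + Num.sqrt rho^-1) * D `^ (1 - theta)), (B * D); split.
- by rewrite mulr_gt0// powR_gt0.
- by rewrite mulr_gt0.
exists N.+2 => // -[|[|k]]//= Nk; have {}Nk : (N <= k)%N by [].
split.
  apply: (le_trans (eB (leqW Nk))); rewrite -mulrA ler_pM2l// mul1r.
  apply: (le_trans (aD _ (leqW Nk))); rewrite ler_pM2l//.
  rewrite !powRN lef_pV2 ?posrE ?powR_gt0//.
  by apply: ge0_ler_powR; rewrite ?nnegrE ?ler0n ?ler_nat//; exact: ltW.
apply: (le_trans (@tail_power (1 - theta) k _ _ _ Nk)); try lra.
rewrite -mulrA ler_pM2l//.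
have -> : - ((1 - theta) / (2 * theta - 1)) = - p * (1 - theta).
  by rewrite mulNr mulrC.
have kp : 0 <= k.+2%:R `^ (- p) :> R by exact: powR_ge0.
rewrite powRrM -powRM//; last exact: ltW.
apply: ge0_ler_powR; rewrite ?nnegrE ?a0 ?aD//; first lra.
by rewrite mulr_ge0// ltW.
Qed.

End KLRates.

(** * Descent inequality for the two families of admissible parameters *)

Section Descent.
Context {R : realType} {n : nat}.
Local Notation V := 'rV[R]_n.
Implicit Types (psi fr hr xr : V -> R) (x y w ym : V) (gamma beta m : R).

Definition real_hhat fr hr gamma : V -> R :=
  fun z => gamma^-1 * hr z + (-1) * fr z.

Definition real_fhat fr hr gamma beta : V -> R :=
  fun z => 1 * fr z + (- (beta / gamma)) * hr z.

Lemma hhat_EFin fr hr gamma :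
  hhat (EFin \o fr) (EFin \o hr) gamma = EFin \o real_hhat fr hr gamma.
Proof. by apply/funext => z; rewrite /hhat /real_hhat /= mulN1r dEFinB EFinM. Qed.

Lemma fhat_EFin fr hr gamma beta :
  fhat (EFin \o fr) (EFin \o hr) gamma beta = EFin \o real_fhat fr hr gamma beta.
Proof.
by apply/funext => z; rewrite /fhat /real_fhat /= mul1r mulNr dEFinB EFinM.
Qed.

Lemma bregman_EFin psi x y :
  bregman (EFin \o psi) x y = (real_bregman psi x y)%:E.
Proof. by rewrite /bregman /real_bregman grad_EFin /= !dEFinB. Qed.

Lemma three_point psi w y ym :
  dot (w - y) (gradient psi y - gradient psi ym) =
    real_bregman psi w ym - real_bregman psi w y - real_bregman psi y ym.
Proof.
rewrite dotC /real_bregman.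
have -> : w - ym = (w - y) + (y - ym) by rewrite subrKA.
by rewrite dotBl (dotDr _ (w - y)); ring.
Qed.

(** What makes [Phi + D_xi] decrease by [m D_h] at each step: [w] is the new
    iterate, and the value of the next model at its centre [w] is [phi w]. *)
Definition model_descent fr hr xr gamma beta m : Prop := forall w y ym,
  - real_bregman (real_hhat fr hr gamma) w y
  - dot (w - y) (gradient (real_fhat fr hr gamma beta) y
                 - gradient (real_fhat fr hr gamma beta) ym)
  + real_bregman xr w y
  <= real_bregman xr y ym - m * real_bregman hr w y.

Lemma bregman_hhat fr hr gamma x y : smooth fr -> smooth hr ->
  real_bregman (real_hhat fr hr gamma) x y =
    gamma^-1 * real_bregman hr x y - real_bregman fr x y.
Proof. by move=> fs hs; rewrite bregman_lincomb// mulN1r. Qed.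

Lemma bregman_fhat fr hr gamma beta x y : smooth fr -> smooth hr ->
  real_bregman (real_fhat fr hr gamma beta) x y =
    real_bregman fr x y - beta / gamma * real_bregman hr x y.
Proof. by move=> fs hs; rewrite bregman_lincomb// mul1r mulNr. Qed.

(** A relative weak concavity modulus of [f] is an upper bound on its Bregman
    distance, as the Bregman distance of a convex function is nonnegative. *)
Lemma relative_modulus_bregman fr hr (smf : R) x y : smooth fr -> smooth hr ->
  convex_on setT (fun x => - (EFin \o fr) x - smf%:E * (EFin \o hr) x)%dE ->
  real_bregman fr x y <= - smf * real_bregman hr x y.
Proof.
move=> fs hs cvx.
have E : (fun x => - (EFin \o fr) x - smf%:E * (EFin \o hr) x)%dE =
    EFin \o (fun z => (-1) * fr z + (- smf) * hr z).
  by apply/funext => z /=; rewrite mulN1r mulNr dEFinB EFinM EFinN.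
rewrite E in cvx.
have := convex_bregman_ge0 x y (smooth_lincomb (-1) (- smf) fs hs) cvx.
by rewrite bregman_lincomb//; lra.
Qed.

(** In the three-point expansion of the inertial term, the Bregman distance of
    [fhat] from [w] to [ym] enters with a negative sign and can be dropped, since
    [fhat] is convex. *)
Lemma admissible_A_descent fr hr (sf smf gamma beta c : R) xi :
  smooth fr -> smooth hr -> 0 < gamma -> 0 < Lfh sf smf ->
  relative_moduli setT (EFin \o fr) (EFin \o hr) sf smf ->
  admissible_A setT (EFin \o fr) (EFin \o hr) sf smf gamma beta c xi ->
  exists xr m, [/\ xi = EFin \o xr, smooth xr, forall x y, 0 <= real_bregman xr x y,
    0 < m & model_descent fr hr xr gamma beta m].
Proof.
move=> fs hs g0 L0 [_ cvxmf] [cvx _ -> -> c0].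
rewrite fhat_EFin in cvx *.
have fhs : smooth (real_fhat fr hr gamma beta) by exact: smooth_lincomb.
have fh0 x y : 0 <= real_bregman (real_fhat fr hr gamma beta) x y.
  exact: convex_bregman_ge0.
exists (real_fhat fr hr gamma beta).
set m := (X in 0 < X) in c0; exists (m / gamma); split=> //.
  by rewrite divr_gt0.
move=> w y ym; rewrite three_point bregman_hhat// -(subr_ge0 (_ + _)).
have := relative_modulus_bregman w y fs hs cvxmf.
have := fh0 w ym; have := fh0 y ym.
set a := real_bregman (real_fhat fr hr gamma beta) w ym.
set b := real_bregman (real_fhat fr hr gamma beta) y ym.
rewrite (bregman_fhat _ _ w y)//.
set Dh := real_bregman hr w y; set Df := real_bregman fr w y => b0 a0 H.
have -> : m / gamma * Dh = gamma^-1 * Dh + 2 * (beta / gamma) * Dh + 3 * smf * Dh.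
  by rewrite /m; field; rewrite !gt_eqF.
lra.
Qed.

Lemma strongly_convex_bregman hr (s : R) x y : smooth hr ->
  strongly_convex s (EFin \o hr) ->
  s / 2 * enorm (x - y) ^+ 2 <= real_bregman hr x y.
Proof.
move=> hs; rewrite /strongly_convex.
have -> : edom (EFin \o hr) = setT.
  by apply/seteqP; split=> z // _; rewrite /edom /= ltry.
have -> : (fun x => (EFin \o hr) x - (s / 2 * enorm x ^+ 2)%:E)%dE =
    EFin \o (fun z => 1 * hr z + (-1) * (s / 2 * enorm z ^+ 2)).
  by apply/funext => z /=; rewrite mul1r mulN1r dEFinB.
have qs := @smooth_halfsq R n s.
move=> /(convex_bregman_ge0 x y (smooth_lincomb 1 (-1) hs qs)).
by rewrite (bregman_lincomb 1 (-1) x y hs qs) bregman_halfsq; lra.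
Qed.

(** The inertial term is split by Young's inequality and its half in the current
    step is absorbed in [D_h] by strong convexity.  The decrease is
    [c / (sh gamma)], with the modulus [sh] in the denominator. *)
Lemma admissible_B_descent fr hr (sf smf gamma beta c : R) xi :
  smooth fr -> smooth hr -> 0 < gamma -> 0 < Lfh sf smf ->
  relative_moduli setT (EFin \o fr) (EFin \o hr) sf smf ->
  admissible_B setT (EFin \o fr) (EFin \o hr) sf smf gamma beta c xi ->
  exists xr m, [/\ xi = EFin \o xr, smooth xr, forall x y, 0 <= real_bregman xr x y,
    0 < m & model_descent fr hr xr gamma beta m].
Proof.
move=> fs hs g0 L0 [_ cvxmf] [Lh [sh [Lh0 sh0 [lip scvx -> -> c0]]]].
exists (fun z => Lh / 2 * enorm z ^+ 2).
set m := (X in 0 < X) in c0; exists (m / (sh * gamma)).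
split.
- by [].
- exact: smooth_halfsq.
- move=> x y; rewrite bregman_halfsq; apply: mulr_ge0; last exact: sqr_ge0.
  by rewrite divr_ge0.
- by rewrite divr_gt0// mulr_gt0.
move=> w y ym; rewrite !bregman_halfsq bregman_hhat//.
have := relative_modulus_bregman w y fs hs cvxmf.
have := strongly_convex_bregman w y hs scvx.
have := lip y ym I I; rewrite fhat_EFin grad_EFin.
set u := gradient _ y - gradient _ ym => lu.
have := dot_le_enorm (- (w - y)) u; rewrite dotNl enormN.
set Dh := real_bregman hr w y; set Df := real_bregman fr w y => H1 H2 H3.
set p := enorm (w - y) in H1 H2 *; set q := enorm (y - ym) in lu *.
have p0 : 0 <= p by exact: enorm_ge0.
have {}H1 : - dot (w - y) u <= Lh / 2 * (p ^+ 2 + q ^+ 2).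
  apply: (le_trans H1); apply: (@le_trans _ _ (p * (Lh * q))).
    by rewrite ler_wpM2l.
  have : 0 <= Lh * (p - q) ^+ 2 by apply: mulr_ge0 => //; exact: sqr_ge0.
  by nra.
have {}H2 : Lh * p ^+ 2 <= 2 * Lh / sh * Dh.
  have -> : Lh * p ^+ 2 = 2 * Lh / sh * (sh / 2 * p ^+ 2).
    by field; rewrite gt_eqF.
  by rewrite ler_wpM2l// divr_ge0 ?mulr_ge0// ltW.
have -> : m / (sh * gamma) * Dh = gamma^-1 * Dh + smf * Dh - 2 * Lh / sh * Dh.
  by rewrite /m; field; rewrite !gt_eqF.
lra.
Qed.

Lemma admissible_descent fr hr (sf smf gamma beta c : R) xi :
  smooth fr -> smooth hr -> 0 < Lfh sf smf ->
  relative_moduli setT (EFin \o fr) (EFin \o hr) sf smf ->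
  admissible setT (EFin \o fr) (EFin \o hr) sf smf gamma beta c xi ->
  [/\ 0 < gamma, 0 < c & exists xr m,
    [/\ xi = EFin \o xr, smooth xr, forall x y, 0 <= real_bregman xr x y,
      0 < m & model_descent fr hr xr gamma beta m]].
Proof.
move=> fs hs L0 rel [g0 adm]; split=> //.
  by case: adm => [[]|[? [? [_ _ []]]]].
case: adm; first exact: admissible_A_descent.
exact: admissible_B_descent.
Qed.

End Descent.

(** * Subgradients of the potential along the iterates *)

Lemma subrACAB (Z : zmodType) (a b c d : Z) : a - b - (c - d) = a - c - (b - d).
Proof. by rewrite !opprD !opprK addrACA. Qed.

Section GradientBound.
Context {R : realType} {n : nat}.
Local Notation V := 'rV[R]_n.
Implicit Types (psi : V -> R) (w x y : V).

(** The gradient is bounded by the local Lipschitz constant: test the expansion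
    in the direction of the gradient itself. *)
Lemma gradient_le_lipschitz psi x (L : R) : 0 <= L -> differentiable psi x ->
  (forall e : R, 0 < e -> exists2 d : R, 0 < d & forall y, enorm (y - x) < d ->
     `|psi y - psi x| <= (L + e) * enorm (y - x)) ->
  enorm (gradient psi x) <= L.
Proof.
move=> L0 dx lip; apply/ler_addgt0Pr => e e0.
have e20 : 0 < e / 2 by rewrite divr_gt0.
have [d1 d10 H1] := lip _ e20.
have [d2 d20 H2] := differentiable_expansion dx e20.
set g := gradient psi x in H2 *.
have [g0|g0] := eqVneq (enorm g) 0; first by rewrite g0 addr_ge0// ltW.
have pg : 0 < enorm g by rewrite lt_neqAle eq_sym g0 enorm_ge0.
pose t := Num.min d1 d2 / 2 / enorm g.
have m0 : 0 < Num.min d1 d2 by rewrite lt_min d10.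
have t0 : 0 < t by rewrite !divr_gt0.
have E : enorm (x + t *: g - x) = t * enorm g.
  by rewrite addrAC subrr add0r enormZ gtr0_norm.
have tm : t * enorm g < Num.min d1 d2.
  by rewrite /t divfK ?gt_eqF// ltr_pdivrMr// ltr_pMr// ltr1n.
have := H1 (x + t *: g); have := H2 (x + t *: g).
rewrite E (lt_le_trans tm) ?ge_min ?lexx ?orbT//.
rewrite (lt_le_trans tm) ?ge_min ?lexx ?orbT// => /(_ isT) h2 /(_ isT) h1.
have E' : x + t *: g - x = t *: g by rewrite addrAC subrr add0r.
rewrite E' dotZr -enorm_sqr expr2 in h2.
move: h1 h2; rewrite !ler_norml => /andP[_ h1] /andP[h2 _].
have tg : 0 < t * enorm g by rewrite mulr_gt0.
rewrite -(ler_pM2l tg); lra.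
Qed.

Section Variation.
Variables (psi : V -> R) (r K eps : R).
Hypotheses (K0 : 0 <= K) (eps0 : 0 <= eps) (spsi : smooth psi).
Hypothesis lip : lipschitz_gradient psi r K.

(** By the three-point identity the variation of a Bregman distance is another
    Bregman distance, of order [eps ^ 2], plus an inner product of order [eps]. *)
Lemma bregman_variation_right w y y' :
  enorm y <= r -> enorm y' <= r -> enorm (y' - y) <= eps ->
  `|real_bregman psi w y' - real_bregman psi w y| <=
    K * eps * (2 * eps + enorm (w - y)).
Proof.
move=> yr y'r yy'.
have -> : real_bregman psi w y' - real_bregman psi w y =
   - real_bregman psi y' y - dot (gradient psi y' - gradient psi y) (w - y').
  have := three_point psi w y' y; rewrite dotC => ->; ring.
apply: (le_trans (ler_normB _ _)); rewrite normrN.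
have h1 := bregman_le spsi K0 lip y'r yr.
have h2 := dot_norm_le (gradient psi y' - gradient psi y) (w - y').
have h3 := lip y'r yr.
have h4 : enorm (w - y') <= enorm (w - y) + eps.
  by apply: (le_trans (enorm_dist_triangle y _ _)); rewrite lerD2l enormB.
have n1 := enorm_ge0 (y' - y); have n2 := enorm_ge0 (w - y').
have n3 := enorm_ge0 (w - y).
have h5 : K * enorm (y' - y) <= K * eps by rewrite ler_wpM2l.
have h6 : K * enorm (y' - y) ^+ 2 <= K * eps * eps.
  rewrite expr2 mulrA; apply: ler_pM => //; exact: mulr_ge0.
have h7 : enorm (gradient psi y' - gradient psi y) * enorm (w - y') <=
    K * eps * (enorm (w - y) + eps).
  by apply: ler_pM => //; rewrite ?enorm_ge0// (le_trans h3).
lra.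
Qed.

Lemma bregman_variation_left x x' y :
  enorm x <= r -> enorm x' <= r -> enorm y <= r -> enorm (x' - x) <= eps ->
  `|real_bregman psi x' y - real_bregman psi x y| <=
    K * eps * (eps + enorm (x - y)).
Proof.
move=> xr x'r yr xx'.
have -> : real_bregman psi x' y - real_bregman psi x y =
   real_bregman psi x' x + dot (gradient psi x - gradient psi y) (x' - x).
  have := three_point psi x' x y; rewrite dotC => ->; ring.
apply: (le_trans (ler_normD _ _)).
have h1 := bregman_le spsi K0 lip x'r xr.
have h2 := dot_norm_le (gradient psi x - gradient psi y) (x' - x).
have h3 := lip xr yr.
have n1 := enorm_ge0 (x' - x).
have h6 : K * enorm (x' - x) ^+ 2 <= K * eps * eps.
  rewrite expr2 mulrA; apply: ler_pM => //; first exact: mulr_ge0.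
  by rewrite ler_wpM2l.
have h7 : enorm (gradient psi x - gradient psi y) * enorm (x' - x) <=
    K * enorm (x - y) * eps.
  by apply: ler_pM => //; exact: enorm_ge0.
lra.
Qed.

(** To first order in [eps] the variation is proportional to [enorm (x - y)]:
    this is what makes the subgradients of the potential small at short steps. *)
Lemma bregman_variation x x' y y' :
  enorm x <= r -> enorm x' <= r -> enorm y <= r -> enorm y' <= r ->
  enorm (x' - x) <= eps -> enorm (y' - y) <= eps ->
  `|real_bregman psi x' y' - real_bregman psi x y| <=
    K * eps * (4 * eps + 2 * enorm (x - y)).
Proof.
move=> xr x'r yr y'r xx' yy'.
have h1 := bregman_variation_right x' yr y'r yy'.
have h2 := bregman_variation_left xr x'r yr xx'.
have h3 : enorm (x' - y) <= enorm (x - y) + eps.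
  by apply: (le_trans (enorm_dist_triangle x _ _)); rewrite addrC lerD2l.
have h4 : K * eps * (2 * eps + enorm (x' - y)) <=
    K * eps * (2 * eps + (enorm (x - y) + eps)).
  by rewrite ler_wpM2l ?mulr_ge0// lerD2l.
have := ler_distD (real_bregman psi x' y) (real_bregman psi x' y')
  (real_bregman psi x y); lra.
Qed.

Lemma inner_variation w w' y y' ym ym' :
  enorm y <= r -> enorm y' <= r -> enorm ym <= r -> enorm ym' <= r ->
  enorm (w' - w) <= eps -> enorm (y' - y) <= eps -> enorm (ym' - ym) <= eps ->
  `|dot (w' - y') (gradient psi y' - gradient psi ym')
    - dot (w' - y) (gradient psi y - gradient psi ym)| <=
    K * eps * (4 * eps + 2 * enorm (w - y) + enorm (y - ym)).
Proof.
move=> yr y'r ymr ym'r ww' yy' yym'.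
set g := gradient psi.
have -> : dot (w' - y') (g y' - g ym') - dot (w' - y) (g y - g ym) =
    dot (y - y') (g y' - g ym') + dot (w' - y) (g y' - g y - (g ym' - g ym)).
  have -> : g y' - g y - (g ym' - g ym) = (g y' - g ym') - (g y - g ym).
    exact: subrACAB.
  rewrite [dot (w' - y) (_ - (g y - g ym))]dotBr addrA -dotDl.
  by rewrite [y - y' + _]addrC subrKA.
apply: (le_trans (ler_normD _ _)).
have a1 : enorm (y' - ym') <= 2 * eps + enorm (y - ym).
  have := enorm_dist_triangle y y' ym'; have := enorm_dist_triangle ym y ym'.
  by rewrite (enormB ym ym'); lra.
have a2 : enorm (w' - y) <= eps + enorm (w - y).
  by have := enorm_dist_triangle w w' y; lra.
have a3 : enorm (g y' - g ym') <= K * (2 * eps + enorm (y - ym)).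
  by apply: (le_trans (lip y'r ym'r)); rewrite ler_wpM2l.
have a4 : enorm (g y' - g y - (g ym' - g ym)) <= 2 * (K * eps).
  apply: (le_trans (enormD _ _)); rewrite enormN mulr2n mulrDl mul1r.
  by apply: lerD; [apply: (le_trans (lip y'r yr))|apply: (le_trans (lip ym'r ymr))];
     rewrite ler_wpM2l.
have n1 := enorm_ge0 (w - y); have n2 := enorm_ge0 (y - ym).
have b1 : `|dot (y - y') (g y' - g ym')| <= eps * (K * (2 * eps + enorm (y - ym))).
  apply: (le_trans (dot_norm_le _ _)).
  by apply: ler_pM; rewrite ?enorm_ge0// enormB.
have b2 : `|dot (w' - y) (g y' - g y - (g ym' - g ym))| <=
    (eps + enorm (w - y)) * (2 * (K * eps)).
  by apply: (le_trans (dot_norm_le _ _)); apply: ler_pM; rewrite ?enorm_ge0.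
by move: b1 b2; lra.
Qed.

End Variation.

End GradientBound.

Section ProductSpace.
Context {R : realType}.

Lemma dot_row_mx p q (a c : 'rV[R]_p) (b d : 'rV[R]_q) :
  dot (row_mx a b) (row_mx c d) = dot a c + dot b d.
Proof.
rewrite /dot big_split_ord; congr (_ + _); apply: eq_bigr => i _.
  by rewrite !row_mxEl.
by rewrite !row_mxEr.
Qed.

Lemma enorm_row_mx_sqr p q (a : 'rV[R]_p) (b : 'rV[R]_q) :
  enorm (row_mx a b) ^+ 2 = enorm a ^+ 2 + enorm b ^+ 2.
Proof. by rewrite !enorm_sqr dot_row_mx. Qed.

Lemma enorm_lsubmx p q (z : 'rV[R]_(p + q)) : enorm (lsubmx z) <= enorm z.
Proof.
rewrite -(@ler_pXn2r _ 2%N) ?nnegrE ?enorm_ge0// -{2}(hsubmxK z).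
by rewrite enorm_row_mx_sqr lerDl sqr_ge0.
Qed.

Lemma enorm_rsubmx p q (z : 'rV[R]_(p + q)) : enorm (rsubmx z) <= enorm z.
Proof.
rewrite -(@ler_pXn2r _ 2%N) ?nnegrE ?enorm_ge0// -{2}(hsubmxK z).
by rewrite enorm_row_mx_sqr lerDr sqr_ge0.
Qed.

Lemma enorm_row_mx p q (a : 'rV[R]_p) (b : 'rV[R]_q) :
  enorm (row_mx a b) <= enorm a + enorm b.
Proof.
rewrite -(@ler_pXn2r _ 2%N) ?nnegrE ?addr_ge0 ?enorm_ge0// enorm_row_mx_sqr.
rewrite sqrrD; have := enorm_ge0 a; have := enorm_ge0 b; nra.
Qed.

Lemma differentiable_lsubmx p q (z : 'rV[R]_(p + q)) :
  differentiable (fun z : 'rV[R]_(p + q) => lsubmx z) z.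
Proof.
apply: linear_differentiable => {}z A /nbhs_enormP[e e0 eA].
apply/nbhs_enormP; exists e => // y yz; apply: eA.
by rewrite -linearB; exact: le_lt_trans (enorm_lsubmx _) yz.
Qed.

Lemma differentiable_rsubmx p q (z : 'rV[R]_(p + q)) :
  differentiable (fun z : 'rV[R]_(p + q) => rsubmx z) z.
Proof.
apply: linear_differentiable => {}z A /nbhs_enormP[e e0 eA].
apply/nbhs_enormP; exists e => // y yz; apply: eA.
by rewrite -linearB; exact: le_lt_trans (enorm_rsubmx _) yz.
Qed.

Lemma differentiable_bregman n (W : normedModType R) (psi : 'rV[R]_n -> R)
    (a b : W -> 'rV[R]_n) z : smooth psi ->
  differentiable a z -> differentiable b z ->
  differentiable (fun z => real_bregman psi (a z) (b z)) z.
Proof.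
move=> [d1 d2 _] da db.
have c1 : differentiable (psi \o a) z by exact: differentiable_comp.
have c2 : differentiable (psi \o b) z by exact: differentiable_comp.
have c3 : differentiable (gradient psi \o b) z by exact: differentiable_comp.
have c4 : differentiable (fun z => dot (gradient psi (b z)) (a z - b z)) z.
  exact: (differentiable_dot c3 (differentiableB da db)).
exact: (differentiableB (differentiableB c1 c2) c4).
Qed.

End ProductSpace.

Section Subgradient.
Context {R : realType}.

Lemma frechet_sub_limiting m (F : 'rV[R]_m -> \bar R) z :
  frechet_subdiff F z `<=` limiting_subdiff F z.
Proof.
move=> v vF; have [Fz _] := vF; split=> //.
by exists (fun=> z), (fun=> v); split=> //; exact: cvg_cst.
Qed.

(** A function whose increments dominate those of a differentiable [G] has the
    gradient of [G] as a regular subgradient. *)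
Lemma gradient_frechet_subdiff m (F : 'rV[R]_m -> \bar R) (G : 'rV[R]_m -> R) z :
  F z \is a fin_num -> differentiable G z ->
  (forall z', (F z + (G z' - G z)%:E <= F z')%E) ->
  frechet_subdiff F z (gradient G z).
Proof.
move=> Fz dG FG; split=> // e e0.
have [d d0 dP] := differentiable_expansion dG e0.
apply/nbhs_enormP; exists d => // z' /dP; rewrite ler_norml => /andP[H _].
apply: le_trans (FG z'); rewrite leeD2lE// lee_fin; lra.
Qed.

End Subgradient.

Lemma variation_sum {R : realType} (K eps e b p p' q t1 t2 t3 t4 : R)
    (c := K * (11 + 4 * `|b|) + 1) :
  0 <= K -> 0 <= eps -> 0 <= p -> 0 <= q -> 0 < c -> eps < e / c ->
  `|t1| <= K * eps * (2 * eps + p') -> p' <= p + eps ->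
  `|t2| <= K * eps * (4 * eps + 2 * p + q) ->
  `|t3| <= K * eps * (4 * eps + 2 * q) ->
  `|t4| <= K * eps * (4 * eps + 2 * q) ->
  `|t1 + t2 + b * t3 + t4| <= (K * (3 + 2 * `|b|) * (p + q) + e) * eps.
Proof.
move=> K0 eps0 p0 q0 c0 ec h1 hp h2 h3 h4.
have ke : 0 <= K * eps by rewrite mulr_ge0.
have {}h1 : `|t1| <= K * eps * (2 * eps + (p + eps)).
  by apply: (le_trans h1); rewrite ler_wpM2l// lerD2l.
have {}h3 : `|b * t3| <= `|b| * (K * eps * (4 * eps + 2 * q)).
  by rewrite normrM ler_wpM2l.
have h : `|t1 + t2 + b * t3 + t4| <= `|t1| + `|t2| + `|b * t3| + `|t4|.
  have := ler_normD (t1 + t2 + b * t3) t4; have := ler_normD (t1 + t2) (b * t3).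
  by have := ler_normD t1 t2; lra.
have hc : eps * c * eps <= e * eps.
  by rewrite ler_wpM2r// -ler_pdivlMr// ltW.
have bp : 0 <= `|b| * p * (K * eps) by rewrite !mulr_ge0.
have := normr_ge0 b; set B := `|b| in c c0 ec hc bp h3 *.
have ee : 0 <= eps * eps by rewrite mulr_ge0.
have kp : 0 <= K * eps * p by rewrite mulr_ge0.
have kq : 0 <= K * eps * q by rewrite mulr_ge0.
rewrite /c in hc; lra.
Qed.

Section ModelSubgradient.
Context {R : realType} {n : nat}.
Local Notation V := 'rV[R]_n.
Variables (fr hh ff hr xr : V -> R) (b : R).
Hypotheses (fs : smooth fr) (hhs : smooth hh) (ffs : smooth ff)
  (hs : smooth hr) (xs : smooth xr).

(** The model without its nonsmooth term [g]. *)
Definition model_smooth_part w y ym : R :=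
  fr w + real_bregman hh w y + dot (w - y) (gradient ff y - gradient ff ym).

(** The potential without its nonsmooth term [g]. *)
Definition potential_smooth_part w y ym : R :=
  model_smooth_part w y ym + b * real_bregman hr y ym + real_bregman xr y ym.

Local Notation p1 z := (lsubmx z).
Local Notation p2 z := (lsubmx (rsubmx z)).
Local Notation p3 z := (rsubmx (rsubmx z)).

Lemma common_lipschitz (r : R) : exists2 K : R, 0 <= K &
  [/\ lipschitz_gradient hh r K, lipschitz_gradient ff r K,
      lipschitz_gradient hr r K & lipschitz_gradient xr r K].
Proof.
have [_ _ /(_ r)[K1 K10 L1]] := hhs; have [_ _ /(_ r)[K2 K20 L2]] := ffs.
have [_ _ /(_ r)[K3 K30 L3]] := hs; have [_ _ /(_ r)[K4 K40 L4]] := xs.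
exists (K1 + K2 + K3 + K4); first by rewrite !addr_ge0.
have weak psi (K K' : R) : K <= K' -> lipschitz_gradient psi r K ->
    lipschitz_gradient psi r K'.
  move=> KK' L x y xr' yr'; apply: (le_trans (L x y xr' yr')).
  by rewrite ler_wpM2r// enorm_ge0.
by split; [apply: weak L1|apply: weak L2|apply: weak L3|apply: weak L4]; lra.
Qed.

(** What remains of the potential at [z] once the model with centre [y], which
    the first block of the reference point minimizes, has been subtracted. *)
Definition residual_part y ym (z : 'rV[R]_(n + (n + n))) : R :=
  potential_smooth_part (p1 z) (p2 z) (p3 z) - model_smooth_part (p1 z) y ym.

Let dp1 z : differentiable (fun z : 'rV[R]_(n + (n + n)) => p1 z) z.
Proof. exact: differentiable_lsubmx. Qed.

Let dp2 z : differentiable (fun z : 'rV[R]_(n + (n + n)) => p2 z) z.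
Proof.
exact: (differentiable_comp (differentiable_rsubmx z)
          (differentiable_lsubmx (rsubmx z))).
Qed.

Let dp3 z : differentiable (fun z : 'rV[R]_(n + (n + n)) => p3 z) z.
Proof.
exact: (differentiable_comp (differentiable_rsubmx z)
          (differentiable_rsubmx (rsubmx z))).
Qed.

Let dmodel (c2 c3 : 'rV[R]_(n + (n + n)) -> V) z :
  differentiable c2 z -> differentiable c3 z ->
  differentiable (fun z => model_smooth_part (p1 z) (c2 z) (c3 z)) z.
Proof.
move=> d2 d3; have [df _ _] := fs; have [_ dg _] := ffs.
have e1 : differentiable (fr \o (fun z => p1 z)) z.
  exact: (differentiable_comp (dp1 z) (df _)).
have e2 := differentiable_bregman hhs (dp1 z) d2.
have e3 : differentiable (gradient ff \o c2) z.
  exact: (differentiable_comp d2 (dg _)).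
have e4 : differentiable (gradient ff \o c3) z.
  exact: (differentiable_comp d3 (dg _)).
have e5 := differentiable_dot (differentiableB (dp1 z) d2) (differentiableB e3 e4).
exact: (differentiableD (differentiableD e1 e2) e5).
Qed.

Lemma differentiable_residual y ym z : differentiable (residual_part y ym) z.
Proof.
have e1 := dmodel (dp2 z) (dp3 z).
have e2 := differentiable_bregman hs (dp2 z) (dp3 z).
have e3 := differentiable_bregman xs (dp2 z) (dp3 z).
have e4 := dmodel (@differentiable_cst _ _ _ y z) (@differentiable_cst _ _ _ ym z).
have e5 := differentiableD (differentiableD e1 (differentiableZ b e2)) e3.
exact: (differentiableB e5 e4).
Qed.

(** The gradient of the residual is estimated through its local Lipschitz
    constant, which avoids computing the Hessians that it contains. *)
Lemma residual_gradient_le (r : R) : exists2 K : R, 0 <= K &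
  forall w y ym, enorm w <= r -> enorm y <= r -> enorm ym <= r ->
    enorm (gradient (residual_part y ym) (row_mx w (row_mx y ym))) <=
      K * (enorm (w - y) + enorm (y - ym)).
Proof.
have [K K0 [L1 L2 L3 L4]] := common_lipschitz (r + 1).
have b0 := normr_ge0 b.
have Kb : 0 <= K * (3 + 2 * `|b|) by rewrite mulr_ge0//; lra.
exists (K * (3 + 2 * `|b|)) => // w y ym wr yr ymr.
set z := row_mx w (row_mx y ym).
have n1 := enorm_ge0 (w - y); have n2 := enorm_ge0 (y - ym).
apply: gradient_le_lipschitz.
- by rewrite mulr_ge0// addr_ge0.
- exact: differentiable_residual.
move=> e e0; pose c := K * (11 + 4 * `|b|) + 1.
have c0 : 0 < c by rewrite /c ltr_wpDl// mulr_ge0//; lra.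
exists (Num.min 1 (e / c)); first by rewrite lt_min ltr01 divr_gt0.
move=> z'; rewrite lt_min => /andP[z1 ze].
set eps := enorm (z' - z) in z1 ze *.
have eps0 : 0 <= eps by exact: enorm_ge0.
have zw : p1 z = w by rewrite row_mxKl.
have zy : p2 z = y by rewrite row_mxKr row_mxKl.
have zm : p3 z = ym by rewrite !row_mxKr.
set w' := p1 z'; set y' := p2 z'; set ym' := p3 z'.
have ww' : enorm (w' - w) <= eps.
  by rewrite -zw -linearB; exact: enorm_lsubmx.
have yy' : enorm (y' - y) <= eps.
  rewrite -zy -linearB; apply: (le_trans (enorm_lsubmx _)).
  by rewrite -linearB; exact: enorm_rsubmx.
have ym'm : enorm (ym' - ym) <= eps.
  rewrite -zm -linearB; apply: (le_trans (enorm_rsubmx _)).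
  by rewrite -linearB; exact: enorm_rsubmx.
have shift (u u' : V) : enorm u <= r -> enorm (u' - u) <= eps -> enorm u' <= r + 1.
  move=> ur uu'; rewrite -(subrK u u') addrC [r + 1]addrC.
  by apply: (le_trans (enormD _ _)); rewrite addrC; apply: lerD => //; lra.
have grow (u : V) : enorm u <= r -> enorm u <= r + 1 by lra.
have h1 := bregman_variation_right K0 hhs L1 w' (grow _ yr) (shift _ _ yr yy') yy'.
have h2 := inner_variation K0 L2 (grow _ yr) (shift _ _ yr yy')
  (grow _ ymr) (shift _ _ ymr ym'm) ww' yy' ym'm.
have h3 := bregman_variation K0 eps0 hs L3 (grow _ yr) (shift _ _ yr yy')
  (grow _ ymr) (shift _ _ ymr ym'm) yy' ym'm.
have h4 := bregman_variation K0 eps0 xs L4 (grow _ yr) (shift _ _ yr yy')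
  (grow _ ymr) (shift _ _ ymr ym'm) yy' ym'm.
have h5 : enorm (w' - y) <= enorm (w - y) + eps.
  by apply: (le_trans (enorm_dist_triangle w _ _)); rewrite addrC lerD2l.
have -> : residual_part y ym z' - residual_part y ym z =
    (real_bregman hh w' y' - real_bregman hh w' y) +
    (dot (w' - y') (gradient ff y' - gradient ff ym')
     - dot (w' - y) (gradient ff y - gradient ff ym)) +
    b * (real_bregman hr y' ym' - real_bregman hr y ym) +
    (real_bregman xr y' ym' - real_bregman xr y ym).
  rewrite /residual_part /potential_smooth_part /model_smooth_part zw zy zm.
  rewrite -/w' -/y' -/ym'.
  move: (dot _ _) (dot _ _) (dot _ _) (real_bregman _ _ _) (real_bregman _ _ _)
    (real_bregman _ _ _) (real_bregman _ _ _) (real_bregman _ _ _)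
    (real_bregman _ _ _) (real_bregman _ _ _) (fr _) (fr _).
  by move=> *; ring.
exact: (variation_sum K0 eps0 n1 n2 c0 ze h1 h5 h2 h3 h4).
Qed.

End ModelSubgradient.

(** * The iterates: descent, boundedness and limit points *)

Section Translation.
Context {R : realType} {n : nat}.
Local Notation V := 'rV[R]_n.
Variables (fr hr xr : V -> R) (g : V -> \bar R) (gamma beta c : R).

Local Notation f := (EFin \o fr).
Local Notation h := (EFin \o hr).
Local Notation xi := (EFin \o xr).
Local Notation hh := (real_hhat fr hr gamma).
Local Notation ff := (real_fhat fr hr gamma beta).

Lemma model_EFin y ym w : model f g h gamma beta y ym w =
  (g w + (model_smooth_part fr hh ff w y ym)%:E)%E.
Proof.
rewrite /model /phi hhat_EFin fhat_EFin bregman_EFin !grad_EFin /model_smooth_part.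
case: (g w) => [r| |] //; rewrite -!dEFinD -EFinD; congr EFin; ring.
Qed.

Lemma potential_EFin (b := c / (2 * gamma)) w y ym :
  potential f g h gamma beta c xi w y ym =
  (g w + (potential_smooth_part fr hh ff hr xr b w y ym)%:E)%E.
Proof.
rewrite /potential model_EFin !bregman_EFin /potential_smooth_part /b.
case: (g w) => [r| |] //; rewrite -EFinM -!EFinD -!dEFinD; congr EFin; ring.
Qed.

Lemma envelope_argmin y ym w : argmin (model f g h gamma beta y ym) w ->
  envelope f g h gamma beta y ym = model f g h gamma beta y ym w.
Proof.
move=> wmin; apply/le_anti/andP; split.
  by apply: ereal_inf_lbound; exists w.
by apply: le_ereal_inf_tmp => _ [w' _ <-]; exact: wmin.
Qed.

End Translation.

Section ClusterPoints.
Context {R : realType} {m : nat}.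
Implicit Types (z : nat -> 'rV[R]_m) (p : 'rV[R]_m).

Lemma cluster_frequently z p (eps : R) (N : nat) : cluster (z @ \oo) p ->
  0 < eps -> exists2 k, (N <= k)%N & enorm (z k - p) < eps.
Proof.
move=> zp eps0.
have nP : nbhs p [set y | enorm (y - p) < eps] by apply/nbhs_enormP; exists eps.
have FA : (z @ \oo) [set z k | k in [set k | (N <= k)%N]].
  by exists N => // k Nk; exists k.
by have [_ [[k Nk <-] zk]] := zp _ _ FA nP; exists k.
Qed.

Lemma cvg_cluster_point z p : z @ \oo --> p -> cluster (z @ \oo) p.
Proof.
move=> zp A B FA /zp FB; 
have [k [Ak Bk]] := @filter_ex _ (z @ \oo) _ _ (filterI FA FB).
by exists k.
Qed.

(** A bounded sequence is eventually close to the set of its cluster points: the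
    indices that violate this would, by compactness, have a cluster point of
    their own. *)
Lemma near_enlargement_cluster z (M r : R) : 0 < r ->
  (forall k, enorm (z k) <= M) ->
  \forall k \near \oo, enlargement (cluster (z @ \oo)) r (z k).
Proof.
move=> r0 zM; set Om := cluster (z @ \oo); apply: contrapT => far.
pose B := [set k | ~ enlargement Om r (z k)].
pose G := within B (\oo : set_system nat).
have PG : ProperFilter G.
  split; last exact: within_filter.
  rewrite /G /within /= => H; apply: far; near=> k.
  apply: contrapT => kB.
  by move: kB; near: k; apply: filterS H => k /= H1 H2; exact: H1.
have GM : (z @ G) [set y | enorm y <= M].
  by rewrite /fmap /nbhs /= /G /within /=; apply: filterE => k _; exact: zM.
have PzG : ProperFilter (z @ G) by exact: fmap_proper_filter.
have [p [_ pG]] := enorm_ball_compact PzG GM.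
have pO : Om p.
  move=> A C FA nC; apply: pG => //.
  have FA' : \forall k \near \oo, A (z k) by exact: FA.
  by rewrite /fmap /nbhs /= /G /within /=; apply: filterS FA' => k Ak _.
have nP : nbhs p [set y | enorm (y - p) < r] by apply/nbhs_enormP; exists r.
have GB : (z @ G) [set z k | k in B].
  by rewrite /fmap /nbhs /= /G /within /=; apply: filterE => k Bk; exists k.
have [_ [[k Bk <-] yk]] := pG _ _ GB nP.
apply: Bk; rewrite /enlargement /dist_set /=.
apply: (@le_lt_trans _ _ (enorm (z k - p))%:E); last by rewrite lte_fin.
by apply: ereal_inf_lbound; exists p.
Unshelve. all: by end_near. Qed.

End ClusterPoints.

(** When the steps tend to 0, consecutive iterates have the same cluster points. *)
Lemma cluster_consecutive {R : realType} {n : nat} (x : nat -> 'rV[R]_n)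
    (zs : nat -> 'rV[R]_(n + (n + n))) w y ym :
  enorm (x j.+1 - x j) @[j --> \oo] --> (0 : R) ->
  (forall j, zs j.+1 = triple (x j.+2) (x j.+1) (x j)) ->
  cluster (zs @ \oo) (row_mx w (row_mx y ym)) ->
  [/\ y = w, ym = w & forall (e : R) N, 0 < e -> exists j, [/\ (N <= j)%N,
    enorm (x j.+2 - w) < e, enorm (x j.+1 - w) < e & enorm (x j - w) < e]].
Proof.
move=> d0 zsE Oz.
have freq (e1 : R) N : 0 < e1 -> exists j, [/\ (N <= j)%N, enorm (x j.+2 - w) < e1,
    enorm (x j.+1 - y) < e1 & enorm (x j - ym) < e1].
  move=> e10; have [[|j]// Nj] := cluster_frequently N.+1 Oz e10.
  rewrite zsE /triple !opp_row_mx !add_row_mx => ze; exists j; split=> //.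
  - by have := enorm_lsubmx (row_mx (x j.+2 - w) (row_mx (x j.+1 - y) (x j - ym)));
       rewrite row_mxKl => h; exact: le_lt_trans h ze.
  - have h1 := enorm_rsubmx (row_mx (x j.+2 - w) (row_mx (x j.+1 - y) (x j - ym))).
    rewrite row_mxKr in h1.
    have := enorm_lsubmx (row_mx (x j.+1 - y) (x j - ym)).
    by rewrite row_mxKl => h; exact: le_lt_trans h (le_lt_trans h1 ze).
  - have h1 := enorm_rsubmx (row_mx (x j.+2 - w) (row_mx (x j.+1 - y) (x j - ym))).
    rewrite row_mxKr in h1.
    have := enorm_rsubmx (row_mx (x j.+1 - y) (x j - ym)).
    by rewrite row_mxKr => h; exact: le_lt_trans h (le_lt_trans h1 ze).
have small (u : 'rV[R]_n) : (forall e1 : R, 0 < e1 -> enorm u <= e1) -> u = 0.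
  move=> small; apply/enorm_eq0/le_anti; rewrite enorm_ge0 andbT.
  by apply/ler_addgt0Pr => e1 e10; rewrite add0r small.
have dsm (e1 : R) : 0 < e1 -> exists N, forall j, (N <= j)%N ->
    enorm (x j.+1 - x j) < e1.
  move=> e10; have /cvgrPdist_lt/(_ _ e10)[N _ HN] := d0; exists N => j /HN.
  by rewrite sub0r normrN ger0_norm// enorm_ge0.
have yw : y = w.
  apply/eqP; rewrite -subr_eq0; apply/eqP/small => e1 e10.
  have e3 : 0 < e1 / 3 by rewrite divr_gt0.
  have [N HN] := dsm _ e3; have [j [Nj h1 h2 _]] := freq _ N e3.
  have := HN j.+1 (leqW Nj).
  have := enorm_dist_triangle (x j.+1) y w.
  have := enorm_dist_triangle (x j.+2) (x j.+1) w.
  rewrite (enormB y (x j.+1)) (enormB (x j.+1) (x j.+2)); lra.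
have ymy : ym = y.
  apply/eqP; rewrite -subr_eq0; apply/eqP/small => e1 e10.
  have e3 : 0 < e1 / 3 by rewrite divr_gt0.
  have [N HN] := dsm _ e3; have [j [Nj _ h1 h2]] := freq _ N e3.
  have := HN j Nj.
  have := enorm_dist_triangle (x j) ym y.
  have := enorm_dist_triangle (x j.+1) (x j) y.
  rewrite (enormB ym (x j)) (enormB (x j) (x j.+1)); lra.
by split=> //; [rewrite ymy|rewrite ymy yw in freq].
Qed.

(** Hypotheses in terms of real-valued functions: [x j.+2] minimizes the model
    built at [x j.+1] and [x j]. *)
Section Iterates.
Context {R : realType} {n : nat}.
Local Notation V := 'rV[R]_n.
Variables (fr hr xr : V -> R) (g : V -> \bar R) (gamma beta b m lb : R).
Variable x : nat -> V.

Local Notation hh := (real_hhat fr hr gamma).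
Local Notation ff := (real_fhat fr hr gamma beta).
Local Notation MP := (model_smooth_part fr hh ff).
Local Notation ph w := (fine (g w) + fr w).

Hypotheses (fs : smooth fr) (hs : smooth hr) (xs : smooth xr).
Hypotheses (b0 : 0 < b) (m0 : 0 < m).
Hypothesis xr_ge0 : forall u v, 0 <= real_bregman xr u v.
Hypothesis descent : model_descent fr hr xr gamma beta m.
Hypothesis coercive : forall r : R, exists2 mu : R, 0 < mu &
  forall u v, enorm u <= r -> enorm v <= r ->
    mu * enorm (u - v) ^+ 2 <= real_bregman hr u v.
Hypothesis g_lsc : lower_semicontinuous g.
Hypothesis g_fin : forall j, g (x j.+2) \is a fin_num.
Hypothesis x_min : forall j w,
  (g (x j.+2) + (MP (x j.+2) (x j.+1) (x j))%:E
     <= g w + (MP w (x j.+1) (x j))%:E)%E.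
Hypothesis ph_lb : forall j, lb <= ph (x j.+2).
Hypothesis ph_level : forall a : R, exists M : R, forall j,
  ph (x j.+2) <= a -> enorm (x j.+2) <= M.

(** The Lyapunov function [Phi + D_xi] along the iterates.  Indices are shifted
    by one, so that the three points are iterates with nonnegative indices. *)
Definition lyapunov j : R :=
  fine (g (x j.+2)) + MP (x j.+2) (x j.+1) (x j) + real_bregman xr (x j.+1) (x j).

Local Notation A := lyapunov.
Local Notation D j := (real_bregman hr (x j.+1) (x j)).
Local Notation d j := (enorm (x j.+1 - x j)).

Let hhs : smooth hh. Proof. exact: smooth_lincomb. Qed.
Let ffs : smooth ff. Proof. exact: smooth_lincomb. Qed.

Lemma x_min_real j w : g w \is a fin_num ->
  fine (g (x j.+2)) + MP (x j.+2) (x j.+1) (x j) <=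
    fine (g w) + MP w (x j.+1) (x j).
Proof.
move=> gw; have := x_min j w.
by rewrite -(fineK (g_fin j)) -(fineK gw) -!EFinD lee_fin.
Qed.

Lemma model_smooth_part_center y ym : MP y y ym = fr y.
Proof. by rewrite /model_smooth_part real_bregman_self subrr dot0l !addr0. Qed.

Lemma lyapunov_ge j :
  ph (x j.+2) + real_bregman xr (x j.+2) (x j.+1) + m * D j.+1 <= A j.
Proof.
have := descent (x j.+2) (x j.+1) (x j).
rewrite /lyapunov /model_smooth_part; lra.
Qed.

Lemma lyapunov_le j :
  A j.+1 <= ph (x j.+2) + real_bregman xr (x j.+2) (x j.+1).
Proof.
have := x_min_real j.+1 (g_fin j); rewrite model_smooth_part_center /lyapunov.
by rewrite lerD2r.
Qed.

Lemma lyapunov_step j : A j.+1 + m * D j.+1 <= A j.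
Proof. by apply: le_trans (lyapunov_ge j); rewrite lerD2r lyapunov_le. Qed.

Let D_ge0 j : 0 <= D j.
Proof.
have [mu mu0 H] := coercive (enorm (x j.+1) + enorm (x j)).
apply: le_trans (H _ _ _ _); rewrite ?lerDl ?lerDr ?enorm_ge0//.
by apply: mulr_ge0; [exact: ltW | exact: sqr_ge0].
Qed.

Let mD_ge0 j : 0 <= m * D j.
Proof. exact: mulr_ge0 (ltW m0) (D_ge0 j). Qed.

Lemma lyapunov_nonincreasing : nonincreasing_seq A.
Proof.
apply/nonincreasing_seqP => j.
by have := lyapunov_step j; have := mD_ge0 j.+1; lra.
Qed.

Lemma ph_le_lyapunov j : ph (x j.+2) <= A j.
Proof.
have := lyapunov_ge j; have := mD_ge0 j.+1.
by have := xr_ge0 (x j.+2) (x j.+1); lra.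
Qed.

Lemma lyapunov_cvg : A @ \oo --> lim (A @ \oo).
Proof.
apply: nonincreasing_is_cvgn; first exact: lyapunov_nonincreasing.
exists lb => _ [j _ <-]; exact: le_trans (ph_lb j) (ph_le_lyapunov j).
Qed.

Lemma lim_le_lyapunov j : lim (A @ \oo) <= A j.
Proof.
apply: nonincreasing_cvgn_ge; first exact: lyapunov_nonincreasing.
exact: lyapunov_cvg.
Qed.

Lemma iterates_bounded : exists r : R, forall j, enorm (x j) <= r.
Proof.
have [M HM] := ph_level (A 0%N).
exists (enorm (x 0%N) + enorm (x 1%N) + `|M|) => -[|[|j]].
- by rewrite -addrA lerDl addr_ge0// enorm_ge0.
- by rewrite addrAC lerDr addr_ge0// enorm_ge0.
apply: (@le_trans _ _ M).
  apply: HM; apply: (le_trans (ph_le_lyapunov j)).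
  exact: lyapunov_nonincreasing.
by apply: (le_trans (ler_norm M)); rewrite lerDr addr_ge0// enorm_ge0.
Qed.

Lemma bregman_steps_cvg0 : D j @[j --> \oo] --> (0 : R).
Proof.
rewrite -(cvg_shiftS (fun j => D j)).
have c1 : A j - A j.+1 @[j --> \oo] --> (0 : R).
  rewrite -(subrr (lim (A @ \oo))); apply: cvgB; first exact: lyapunov_cvg.
  rewrite (cvg_shiftS A); exact: lyapunov_cvg.
apply/cvgrPdist_lt => e e0.
have /cvgrPdist_lt/(_ _ (mulr_gt0 m0 e0)) := c1; apply: filterS => j.
rewrite !sub0r !normrN [`|real_bregman _ _ _|]ger0_norm// => Ae.
rewrite -(ltr_pM2l m0); apply: le_lt_trans Ae.
by apply: le_trans (ler_norm _); have := lyapunov_step j; lra.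
Qed.

Lemma steps_cvg0 : d j @[j --> \oo] --> (0 : R).
Proof.
have [r xr'] := iterates_bounded; have [mu mu0 H] := coercive r.
apply/cvgrPdist_lt => e e0.
have me : 0 < mu * e ^+ 2 by rewrite mulr_gt0// exprn_gt0.
have /cvgrPdist_lt/(_ _ me) := bregman_steps_cvg0; apply: filterS => j.
rewrite !sub0r !normrN !ger0_norm ?enorm_ge0// => De.
rewrite -(@ltr_pXn2r _ 2%N) ?nnegrE ?enorm_ge0// ?ltW//.
by rewrite -(ltr_pM2l mu0); apply: le_lt_trans De; exact: H.
Qed.

(** At a cluster point the potential takes the limiting value of the Lyapunov
    function: one inequality compares the iterates with the cluster point in the
    model, the other is lower semicontinuity. *)
Lemma cluster_value xbar (mu : R) :
  (forall (e : R) N, 0 < e -> exists j, [/\ (N <= j)%N, enorm (x j.+2 - xbar) < e,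
     enorm (x j.+1 - xbar) < e & enorm (x j - xbar) < e]) ->
  g xbar = (mu - fr xbar)%:E -> lim (A @ \oo) = mu.
Proof.
move=> freq gx; apply/le_anti/andP; split.
  have [r xr'] := iterates_bounded.
  pose r' := Num.max r (enorm xbar).
  have xbr : enorm xbar <= r' by rewrite le_max lexx orbT.
  have xjr j : enorm (x j) <= r' by rewrite le_max xr'.
  have [K K0 [L1 L2 _ L4]] := common_lipschitz hhs ffs hs xs r'.
  apply/ler_addgt0Pl => e e0.
  pose c := 7 * K + 1; have c0 : 0 < c by rewrite /c; lra.
  pose eps := Num.min 1 (e / c).
  have eps0 : 0 < eps by rewrite lt_min ltr01 divr_gt0.
  have eps1 : eps <= 1 by rewrite ge_min lexx.
  have [j [_ _ y1 y2]] := freq eps 0%N eps0.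
  apply: (le_trans (lim_le_lyapunov j)).
  have gxf : g xbar \is a fin_num by rewrite gx.
  have := x_min_real j gxf; rewrite gx /= /lyapunov.
  rewrite [MP xbar _ _]/model_smooth_part.
  have n1 := enorm_ge0 (xbar - x j.+1); have n2 := enorm_ge0 (x j.+1 - x j).
  rewrite enormB in y1.
  have y3 : enorm (x j.+1 - x j) <= 2 * eps.
    have := enorm_dist_triangle xbar (x j.+1) (x j).
    by rewrite (enormB xbar (x j)) (enormB _ xbar); lra.
  have sq1 : K * enorm (xbar - x j.+1) ^+ 2 <= K * (eps * eps).
    by rewrite ler_wpM2l// expr2; apply: ler_pM => //; exact: ltW.
  have sq2 : K * enorm (x j.+1 - x j) ^+ 2 <= K * (2 * eps * (2 * eps)).
    by rewrite ler_wpM2l// expr2; apply: ler_pM.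
  have h1 := bregman_le hhs K0 L1 xbr (xjr j.+1).
  have h2 := bregman_le xs K0 L4 (xjr j.+1) (xjr j).
  have h3 := dot_norm_le (xbar - x j.+1) (gradient ff (x j.+1) - gradient ff (x j)).
  have h4 : enorm (xbar - x j.+1) * enorm (gradient ff (x j.+1) - gradient ff (x j))
      <= eps * (K * (2 * eps)).
    apply: ler_pM; rewrite ?enorm_ge0//; first exact: ltW.
    by apply: (le_trans (L2 _ _ (xjr _) (xjr _))); rewrite ler_wpM2l.
  have {}h1 := le_trans h1 sq1; have {}h2 := le_trans h2 sq2.
  have {}h3 := le_trans h3 h4.
  have ke : 7 * K * (eps * eps) <= e.
    apply: (@le_trans _ _ (c * eps)).
      have : 7 * K * (eps * eps) <= 7 * K * eps.
        by rewrite ler_wpM2l ?mulr_ge0// ler_piMl// ltW.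
      by rewrite /c; lra.
    by rewrite mulrC -ler_pdivlMr// ge_min lexx orbT.
  move: h1 h2 h3; rewrite !ler_norml => /andP[_ h1] /andP[_ h2] /andP[_ h3].
  lra.
rewrite leNgt; apply/negP => Amu.
pose eta := (mu - lim (A @ \oo)) / 4.
have eta0 : 0 < eta by rewrite divr_gt0// subr_gt0.
have [U /nbhs_enormP[d1 d10 UP] Ug] : exists2 U : set V, nbhs xbar U &
    forall y, U y -> ((mu - fr xbar - eta)%:E < g y)%E.
  by apply: g_lsc; rewrite gx lte_fin; lra.
have [df _ _] := fs.
have [d2 d20 Uf] : exists2 e : R, 0 < e & forall y, enorm (y - xbar) < e ->
    fr xbar - eta < fr y.
  have nb : nbhs (fr xbar) [set t | fr xbar - eta < t].
    apply/nbhs_ballP; exists eta => //= t; rewrite -ball_normE /= ltr_norml.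
    by move=> /andP[_]; lra.
  by have /nbhs_enormP[e e0 eP] := differentiable_continuous (df xbar) nb; exists e.
have [N _ AN] : \forall j \near \oo, A j < lim (A @ \oo) + eta.
  have /cvgrPdist_lt/(_ _ eta0) := lyapunov_cvg; apply: filterS => j.
  by rewrite ltr_norml => /andP[h _]; lra.
have dmin : 0 < Num.min d1 d2 by rewrite lt_min d10.
have [j [Nj xj _ _]] := freq _ N dmin.
move: xj; rewrite lt_min => /andP[/UP/Ug xj1 /Uf xj2].
move: xj1; rewrite -(fineK (g_fin j)) lte_fin => xj1.
have := AN j Nj; have := ph_le_lyapunov j.
have : mu - lim (A @ \oo) = 4 * eta by rewrite /eta; field.
lra.
Qed.

Local Notation p1 z := (lsubmx z).
Local Notation p2 z := (lsubmx (rsubmx z)).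
Local Notation p3 z := (rsubmx (rsubmx z)).
Local Notation z j := (triple (x j.+2) (x j.+1) (x j)).

Definition real_potential (z : 'rV[R]_(n + (n + n))) : \bar R :=
  (g (p1 z) + (potential_smooth_part fr hh ff hr xr b (p1 z) (p2 z) (p3 z))%:E)%E.

Local Notation F := real_potential.

Lemma real_potential_triple w y ym :
  F (triple w y ym) = (g w + (potential_smooth_part fr hh ff hr xr b w y ym)%:E)%E.
Proof. by rewrite /real_potential /triple row_mxKl !row_mxKr row_mxKl. Qed.

Lemma real_potential_iterate j : F (z j) = (A j + b * D j)%:E.
Proof.
rewrite real_potential_triple -(fineK (g_fin j)) -EFinD; congr EFin.
by rewrite /lyapunov /potential_smooth_part; ring.
Qed.

(** The first block of the subgradient vanishes because [x j.+2] minimizes the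
    model, and the other two are of the order of the last two steps. *)
Lemma small_subgradient : exists2 K : R, 0 < K & forall j,
  exists2 v, limiting_subdiff F (z j) v & enorm v <= K * (d j.+1 + d j).
Proof.
have [r xr'] := iterates_bounded.
have [K K0 HK] := residual_gradient_le b fs hhs ffs hs xs r.
exists (K + 1); first by rewrite ltr_wpDl.
move=> j; pose G := residual_part fr hh ff hr xr b (x j.+1) (x j).
exists (gradient G (z j)).
  apply/frechet_sub_limiting/gradient_frechet_subdiff.
  - by rewrite real_potential_iterate.
  - exact: (differentiable_residual b fs hhs ffs hs xs).
  move=> z'; rewrite real_potential_triple {1}/real_potential.
  have -> : potential_smooth_part fr hh ff hr xr b (p1 z') (p2 z') (p3 z') =
      MP (p1 z') (x j.+1) (x j) + G z' by rewrite /G /residual_part; ring.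
  have -> : potential_smooth_part fr hh ff hr xr b (x j.+2) (x j.+1) (x j) =
      MP (x j.+2) (x j.+1) (x j) + G (z j).
    by rewrite /G /residual_part /triple row_mxKl !row_mxKr row_mxKl; ring.
  have := x_min j (p1 z'); rewrite -(fineK (g_fin j)).
  move: (MP (p1 z') _ _) (MP (x j.+2) _ _) (G z') (G (z j)) => M1 M0 G1 G0.
  move: (fine (g (x j.+2))) (g (p1 z')) => gf [r1| |].
  - by rewrite -!EFinD !lee_fin; lra.
  - by move=> _; rewrite addye// leey.
  - by rewrite addNye -EFinD leeNy_eq.
apply: (le_trans (HK _ _ _ (xr' _) (xr' _) (xr' _))).
by apply: ler_wpM2r; [rewrite addr_ge0 ?enorm_ge0|rewrite lerDl].
Qed.

Section KL.
Variables (mu : R) (U : set 'rV[R]_(n + (n + n))) (eta : \bar R) (psi : R -> R).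
Hypotheses (eta0 : (0 < eta)%E) (cpsi : concave_desing eta psi).
Hypothesis klF : KL_inequality F mu U eta psi.
Hypothesis zU : \forall j \near \oo, U (z j).
Hypothesis limA : lim (A @ \oo) = mu.

Local Notation e j := (A j + b * D j - mu).

Lemma excess_cvg0 : e j @[j --> \oo] --> (0 : R).
Proof.
have -> : (0 : R) = mu + b * 0 - mu by ring.
apply: cvgB; last exact: cvg_cst.
apply: cvgD; first by rewrite -limA; exact: lyapunov_cvg.
by apply: cvgMr; exact: bregman_steps_cvg0.
Qed.

Lemma near_excess_lt : \forall j \near \oo, ((e j)%:E < eta)%E.
Proof.
case: eta eta0 => [r| |] //; last by move=> _; apply: nearW => j; rewrite ltry.
rewrite lte_fin => r0; have /cvgrPdist_lt/(_ _ r0) := excess_cvg0.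
apply: filterS => j; rewrite sub0r normrN lte_fin.
exact: le_lt_trans (ler_norm _).
Qed.

Lemma excess_ge j : A j - mu <= e j.
Proof.
by rewrite lerD2r lerDl mulr_ge0// ltW.
Qed.

Lemma gap_ge0 j : 0 <= A j - mu.
Proof. by rewrite subr_ge0 -limA lim_le_lyapunov. Qed.

Lemma kl_iterates : exists2 K : R, 0 < K & \forall j \near \oo,
  ((e j)%:E < eta)%E /\
  (0 < e j -> 1 <= left_derivative psi (e j) * (K * (d j.+1 + d j))).
Proof.
have [K K0 sub] := small_subgradient; exists K => //.
apply: filterS2 zU near_excess_lt => j Uz ee; split=> // e0.
have := klF Uz; rewrite real_potential_iterate -EFinB /= lte_fin.
move=> /(_ e0 ee); have [v vF vK] := sub j.
have [ld0 _] := left_derivative_chord cpsi (conj (ltW e0) ee) e0.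
have dv : (dist_set 0 (limiting_subdiff F (z j)) <= (K * (d j.+1 + d j))%:E)%E.
  apply: (@le_trans _ _ (enorm (0 - v))%:E).
    by apply: ereal_inf_lbound; exists v.
  by rewrite lee_fin sub0r enormN.
move=> H; rewrite -lee_fin EFinM; apply: (le_trans H).
by apply: lee_wpmul2l => //; rewrite lee_fin.
Qed.

Lemma gap_step : exists2 rho : R, 0 < rho & forall j,
  A j.+1 - mu + rho * d j.+1 ^+ 2 <= A j - mu.
Proof.
have [r xr'] := iterates_bounded; have [nu nu0 H] := coercive r.
exists (m * nu); first by rewrite mulr_gt0.
move=> j; have := lyapunov_step j.
have : m * nu * d j.+1 ^+ 2 <= m * D j.+1.
  by rewrite -mulrA ler_pM2l//; exact: H.
lra.
Qed.

(** Finite length: the Kurdyka-Lojasiewicz inequality makes the iterates converge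
    with an explicit bound on the distance to the limit. *)
Lemma kl_convergence : cvg (x @ \oo) /\
  exists2 C : R, 0 < C & \forall j \near \oo,
    enorm (x j.+1 - lim (x @ \oo)) <= C * psi (A j - mu) + d j / 2.
Proof.
have [K K0 [N _ kl]] := kl_iterates; have [rho rho0 step] := gap_step.
pose C := 2 * K / rho; have C0 : 0 < C by rewrite divr_gt0// mulr_gt0.
pose W j := C * psi (A j - mu) + d j / 2.
have W0 j : (N <= j)%N -> 0 <= W j.
  move=> /kl[ee _]; apply: addr_ge0; last by rewrite divr_ge0 ?enorm_ge0.
  apply: mulr_ge0; first exact: ltW.
  have [[p0 _ ppos _] _] := cpsi; apply: ppos; split; first exact: gap_ge0.
  by apply: le_lt_trans ee; rewrite lee_fin excess_ge.
have WW j : (N <= j)%N -> enorm (x j.+2 - x j.+1) <= W j - W j.+1.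
  move=> /kl[ee klj]; apply: (kl_length_step cpsi rho0 K0 _ _ (gap_ge0 j.+1)
    (step j) (excess_ge j) ee klj); exact: enorm_ge0.
have [cx dx] := telescoping_cvg W0 WW.
have cx' : x @ \oo --> lim (x j.+1 @[j --> \oo]) by rewrite -(cvg_shiftS x).
split; first exact: cvgP cx'.
exists C => //; exists N => // j Nj /=.
rewrite (_ : lim (x @ \oo) = lim (x j.+1 @[j --> \oo])); first exact: dx.
exact: cvg_lim cx'.
Qed.

End KL.

Section PowerKL.
Variables (mu : R) (U : set 'rV[R]_(n + (n + n))) (eta : \bar R) (kappa theta : R).
Let psi (t : R) := kappa * t `^ (1 - theta).
Hypotheses (eta0 : (0 < eta)%E) (cpsi : concave_desing eta psi).
Hypotheses (kappa0 : 0 < kappa) (theta01 : 0 <= theta < 1).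
Hypothesis klF : KL_inequality F mu U eta psi.
Hypothesis zU : \forall j \near \oo, U (z j).
Hypothesis limA : lim (A @ \oo) = mu.

Local Notation e j := (A j + b * D j - mu).
Local Notation l := (lim (x @ \oo)).

(** Comparing the left derivative of [kappa t^(1-theta)] with the chord from 0
    puts the inequality in the form [e^theta <= K (d' + d)]. *)
Lemma power_kl_iterates : exists2 K : R, 0 < K & \forall j \near \oo,
  0 < e j -> e j `^ theta <= K * (d j.+1 + d j).
Proof.
have [K K0 kl] := kl_iterates eta0 cpsi klF zU limA.
exists (kappa * K); first by rewrite mulr_gt0.
apply: filterS kl => j [ee klj] e0; have := klj e0.
have [_ /(_ 0 (e j) (lexx _) (ltW e0) (lexx _))] :=
  left_derivative_chord cpsi (conj (ltW e0) ee) e0.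
have th1 : 1 - theta != 0 by case/andP: theta01 => _ h; rewrite subr_eq0 gt_eqF.
rewrite subr0 /psi powR0// mulr0 subr0.
have -> : e j `^ (1 - theta) = e j / e j `^ theta.
  by rewrite powRB ?powRr1 ?(ltW e0)//; rewrite (gt_eqF e0) implybT.
have et0 : 0 < e j `^ theta by rewrite powR_gt0.
move: e0 et0; move: (e j) (e j `^ theta) (left_derivative _ _) => E T L E0 T0 h1 h2.
have dd : 0 <= d j.+1 + d j by rewrite addr_ge0 ?enorm_ge0.
move: (d j.+1 + d j) dd h2 => S S0 h2.
have {}h1 : L <= kappa / T.
  by rewrite -(ler_pM2r E0); apply: (le_trans h1); rewrite mulrA mulrAC.
have {}h2 : 1 <= kappa / T * (K * S).
  by apply: (le_trans h2); rewrite ler_wpM2r// mulr_ge0// ltW.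
rewrite -(ler_pM2l T0) mulr1 in h2; apply: (le_trans h2).
by rewrite le_eqVlt; apply/orP; left; apply/eqP; field; rewrite gt_eqF.
Qed.

Lemma kl_exponent_rates :
  [/\ theta = 0 -> (\forall k \near \oo, e k = 0) /\ (\forall k \near \oo, x k = l),
      0 < theta <= 1 / 2 -> exists c1 chat1 Q1 Qhat1 : R,
        [/\ 0 < c1, 0 < chat1, 0 <= Q1 < 1, 0 <= Qhat1 < 1
          & \forall k \near \oo,
              e k <= chat1 * Qhat1 ^+ k /\ enorm (x k - l) <= c1 * Q1 ^+ k]
    & 1 / 2 < theta -> exists c2 chat2 : R, [/\ 0 < c2, 0 < chat2
        & \forall k \near \oo,
            e k <= chat2 * k%:R `^ (- (1 / (2 * theta - 1))) /\
            enorm (x k - l) <= c2 * k%:R `^ (- ((1 - theta) / (2 * theta - 1)))]].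
Proof.
have [K K0 kl] := power_kl_iterates.
have [_ [C C0 tail]] := kl_convergence eta0 cpsi klF zU limA.
have [rho rho0 step] := gap_step mu.
have gap1 : \forall j \near \oo, A j - mu <= 1.
  have := lyapunov_cvg; rewrite limA => /cvgrPdist_lt/(_ _ ltr01).
  by apply: filterS => j; rewrite ltr_norml => /andP[h _]; lra.
have [N _ HN] := filterI kl (filterI tail gap1).
have gap0 := gap_ge0 limA.
have Ck0 : 0 < C * kappa by rewrite mulr_gt0.
have B0 : 0 < 1 + b / m by rewrite addr_gt0// divr_gt0.
have H1 j : (N <= j)%N -> 0 <= A j - mu <= 1.
  by move=> /HN[_ [_ g1]]; rewrite gap0 g1.
have H2 j : (N <= j)%N -> A j - mu <= e j by move=> _; exact: excess_ge.
have H3 j : (N <= j)%N -> e j.+1 <= (1 + b / m) * (A j - mu).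
  move=> _; have h1 := lyapunov_step j; have h2 := gap0 j.+1; have h3 := mD_ge0 j.+1.
  have -> : e j.+1 = (A j.+1 - mu) + b / m * (m * D j.+1).
    by field; rewrite gt_eqF.
  rewrite mulrDl mul1r; apply: lerD; first lra.
  by rewrite ler_pM2l ?divr_gt0//; lra.
have H4 j : (N <= j)%N -> 0 < e j -> e j `^ theta <= K * (d j.+1 + d j).
  by move=> /HN[].
have H5 j : (N <= j)%N -> enorm (x j.+1 - l) <=
    C * kappa * (A j - mu) `^ (1 - theta) + d j / 2.
  by move=> /HN[_ [+ _]]; rewrite mulrA.
have H6 j : (N <= j)%N -> A j.+1 - mu + rho * d j.+1 ^+ 2 <= A j - mu by [].
split.
- move=> th0; exact: (kl_finite_termination rho0 K0 H1 H6 H2 H4 H5 th0 steps_cvg0).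
- exact: (kl_linear_convergence rho0 B0 K0 Ck0 H1 H6 H2 H3 H4 H5).
- exact: (kl_sublinear_convergence rho0 B0 K0 Ck0 theta01 H1 H6 H2 H3 H4 H5).
Qed.

End PowerKL.

End Iterates.

(** * Convergence rates of the inertial forward-reflected-backward method *)

Theorem theorem4p9 (R : realType) (n : nat)
  (f g h : 'rV[R]_n -> \bar R)
  (sf smf gamma beta c : R) (xi : 'rV[R]_n -> \bar R)
  (xm1 : 'rV[R]_n) (x : nat -> 'rV[R]_n) (theta : R) :
  standing_assumptions setT f g h ->
  relative_moduli setT f h sf smf ->
  0 < Lfh sf smf ->
  admissible setT f h sf smf gamma beta c xi ->
  (forall k, iFRB_step f g h gamma beta (x k) (previous xm1 x k) (x k.+1)) ->
  level_bounded (phi f g) ->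
  twice_cont_diff f -> twice_cont_diff h -> (forall u, pos_def (hess h u)) ->
  let F := potential3 f g h gamma beta c xi in
  let Omega := limit_points xm1 x in
  (exists (r : R) (eta : \bar R), [/\ 0 < r, (0 < eta)%E
     & KL_on_set F Omega (enlargement Omega r) eta]) ->
  let L := merit f g h gamma beta c xi in
  let phistar := lim (L (x k) (previous xm1 x k) @[k --> \oo]) in
  let e := fun k : nat => (L (x k.+1) (x k) - phistar)%dE in
  let xstar := lim (x @ \oo) in
  KL_exponent F (triple xstar xstar xstar) theta ->
  [/\ theta = 0 ->
        (\forall k \near \oo, e k = 0%E) /\ (\forall k \near \oo, x k = xstar),
      0 < theta <= 1 / 2 ->
        exists c1 chat1 Q1 Qhat1 : R,
          [/\ 0 < c1, 0 < chat1, 0 <= Q1 < 1, 0 <= Qhat1 < 1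
            & \forall k \near \oo,
                (e k <= (chat1 * Qhat1 ^+ k)%:E)%E /\
                enorm (x k - xstar) <= c1 * Q1 ^+ k]
    & 1 / 2 < theta < 1 ->
        exists c2 chat2 : R,
          [/\ 0 < c2, 0 < chat2
            & \forall k \near \oo,
                (e k <= (chat2 * k%:R `^ (- (1 / (2 * theta - 1))))%:E)%E /\
                enorm (x k - xstar)
                  <= c2 * k%:R `^ (- ((1 - theta) / (2 * theta - 1)))]].
Proof.
move=> SA rel L0 adm step lev C2f C2h hpos F Omega KL L phistar e xstar KLe.
have hfin u : h u \is a fin_num.
  have [[hNy _] _ _ _ _ hint _] := kernel_legendre SA.
  have hu : edom h u by apply: interior_subset; rewrite hint.
  by rewrite fin_numE hNy /= lt_eqF.
have ffin u : f u \is a fin_num.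
  have [fNy _] := f_proper SA.
  have hu : edom f u by apply: (f_dom SA); rewrite /edom /= ltey_eq hfin.
  by rewrite fin_numE fNy /= lt_eqF.
pose fr u := fine (f u); pose hr u := fine (h u).
have fE : f = EFin \o fr by apply/funext => u; rewrite /= fineK.
have hE : h = EFin \o hr by apply/funext => u; rewrite /= fineK.
have glsc := g_lsc SA; have [gNy [w0 gw0]] := g_proper SA.
have lb := phi_lower_bounded SA.
have fs : smooth fr by apply: twice_cont_diff_smooth; rewrite -fE.
have hs : smooth hr by apply: twice_cont_diff_smooth; rewrite -hE.
have coer : forall r : R, exists2 mu : R, 0 < mu &
    forall u v, enorm u <= r -> enorm v <= r ->
      mu * enorm (u - v) ^+ 2 <= real_bregman hr u v.
  by move=> r; apply: bregman_coercive_on_ball; rewrite -hE.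
(* From here on [f] and [h] are real-valued functions seen in the extended
   reals, and [xi] as well once admissibility has been unfolded. *)
clearbody fr hr.
move: fE hE => fE hE; subst f h.
have [g0 c0 [xr [m [xiE xs xr0 m0 desc]]]] := admissible_descent fs hs L0 rel adm.
subst xi.
pose b := c / (2 * gamma).
have b0 : 0 < b by rewrite divr_gt0// mulr_gt0.
have xmin j w : (g (x j.+2) + (model_smooth_part fr (real_hhat fr hr gamma)
      (real_fhat fr hr gamma beta) (x j.+2) (x j.+1) (x j))%:E
    <= g w + (model_smooth_part fr (real_hhat fr hr gamma)
      (real_fhat fr hr gamma beta) w (x j.+1) (x j))%:E)%E.
  by rewrite -!model_EFin; exact: step.
have gfin j : g (x j.+2) \is a fin_num.
  rewrite fin_numE gNy /=; apply/eqP => gy; have := xmin j w0.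
  rewrite gy addye// leye_eq; move: gw0; rewrite /edom /=.
  by case: (g w0).
have phE j : phi (EFin \o fr) g (x j.+2) = (fine (g (x j.+2)) + fr (x j.+2))%:E.
  by rewrite /phi -{1}(fineK (gfin j)) -dEFinD addrC.
have [lbr ph_lb] : exists lbr : R, forall j, lbr <= fine (g (x j.+2)) + fr (x j.+2).
  have H j : (ereal_inf (range (phi_closure setT (EFin \o fr) g)) <=
      (fine (g (x j.+2)) + fr (x j.+2))%:E)%E.
    apply: ereal_inf_lbound; exists (x j.+2) => //.
    rewrite /phi_closure phE /indicator closureT mem_set//.
    by rewrite -dEFinD addr0.
  case: ereal_inf lb H => [r| |] // _ H.
    by exists r => j; have := H j; rewrite lee_fin.
  by have := H 0%N; rewrite leye_eq.
have ph_lev (a : R) : exists M : R, forall j,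
    fine (g (x j.+2)) + fr (x j.+2) <= a -> enorm (x j.+2) <= M.
  have /bounded_enormP[M _ HM] := lev a.
  by exists M => j aj; apply: HM; rewrite /= phE lee_fin.
pose A := lyapunov fr hr xr g gamma beta x.
pose D j := real_bregman hr (x j.+1) (x j).
have LE j : L (x j.+1) (x j) = (A j + b * D j)%:E.
  rewrite /L /merit (envelope_argmin (step j.+1)) model_EFin !bregman_EFin.
  rewrite -{1}(fineK (gfin j)) -EFinM -!EFinD -!dEFinD; congr EFin.
  by rewrite /A /D /b /lyapunov; ring.
have FE : F = real_potential fr hr xr g gamma beta b.
  by apply/funext => z; rewrite /F /potential3 potential_EFin.
pose zs k := triple (x k.+1) (x k) (previous xm1 x k).
have OmE : Omega = cluster (zs @ \oo) by [].
have [r [eta [r0 eta0 [mu [[p Op] _ FOm _ [psi [cpsi kl]]]]]]] := KL.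
have d0 := steps_cvg0 m0 xr0 desc coer gfin xmin ph_lb ph_lev.
(* All the limit points are diagonal and share the value [mu] of the potential,
   which identifies the limit of the Lyapunov function, hence [phistar]. *)
have limA : lim (A @ \oo) = mu.
  have := Op; rewrite -(hsubmxK p) -(hsubmxK (rsubmx p)) => /[dup] /FOm.
  rewrite FE => Fp /(cluster_consecutive d0 _)[//|yw ymw freq].
  rewrite yw ymw in Fp.
  apply: (cluster_value fs hs xs m0 xr0 desc coer glsc gfin xmin ph_lb ph_lev freq).
  move: Fp; rewrite -/(triple _ _ _) real_potential_triple.
  rewrite /potential_smooth_part model_smooth_part_center !real_bregman_self.
  rewrite mulr0 !addr0.
  by case: (g _) => [gp| |] //; rewrite -EFinD => -[<-]; rewrite addrK.
have [M xM] := iterates_bounded m0 xr0 desc coer gfin xmin ph_lev.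
have zM k : enorm (zs k) <= M + (M + (M + enorm xm1)).
  have M0 : 0 <= M by exact: le_trans (enorm_ge0 _) (xM 0%N).
  apply: (le_trans (enorm_row_mx _ _)); apply: lerD => //.
  apply: (le_trans (enorm_row_mx _ _)); apply: lerD => //.
  case: k => [|k] /=; first by rewrite lerDr.
  by apply: (le_trans (xM k)); rewrite lerDl enorm_ge0.
have zU : \forall j \near \oo, enlargement Omega r (triple (x j.+2) (x j.+1) (x j)).
  have [N _ HN] := near_enlargement_cluster r0 zM.
  by exists N => // j /= Nj; apply: (HN j.+1); exact: leqW.
rewrite FE in kl KLe.
have [cx _] := kl_convergence fs hs xs b0 m0 xr0 desc coer gfin xmin ph_lb ph_lev
  eta0 cpsi kl zU limA.
(* The setwise property has given the convergence of [x]; the diagonal point is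
   now a limit point, so the pointwise property applies with the same [mu]. *)
have xx : x @ \oo --> xstar by exact: cx.
have zz : zs @ \oo --> triple xstar xstar xstar.
  rewrite -(cvg_shiftS zs); apply/cvg_enormP => e1 e10.
  have e3 : 0 < e1 / 3 by rewrite divr_gt0.
  have /cvg_enormP/(_ _ e3)[N _ HN] := xx; exists N => // j /= Nj.
  have h0 := HN _ Nj; have h1 := HN _ (leqW Nj); have h2 := HN _ (leqW (leqW Nj)).
  rewrite /= in h0 h1 h2.
  rewrite /zs /triple !opp_row_mx !add_row_mx /=.
  have := enorm_row_mx (x j.+2 - xstar) (row_mx (x j.+1 - xstar) (x j - xstar)).
  have := enorm_row_mx (x j.+1 - xstar) (x j - xstar); lra.
have Fstar : F (triple xstar xstar xstar) = mu%:E.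
  by apply: FOm; rewrite OmE; exact: cvg_cluster_point.
have [th01 [kappa kappa0 [_ [U [eta' [nU eta'0 cpsi' kl']]]]]] := KLe.
rewrite -FE Fstar /= FE in kl'.
have zU' : \forall j \near \oo, U (triple (x j.+2) (x j.+1) (x j)).
  have [N _ HN] := zz _ nU.
  by exists N => // j /= Nj; apply: (HN j.+1); exact: leqW.
have phiE : phistar = mu%:E.
  rewrite /phistar; apply: cvg_lim => //.
  rewrite -(cvg_shiftS (fun k => L (x k) (previous xm1 x k))) /=.
  rewrite (_ : (fun j => _) = (fun j => (A j + b * D j)%:E)); last first.
    by apply/funext => j; exact: LE.
  have ex0 := excess_cvg0 b m0 xr0 desc coer gfin xmin ph_lb limA.
  apply: cvg_EFin; first exact: nearW.
  have -> : mu = 0 + mu by rewrite add0r.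
  rewrite (_ : _ \o _ = (fun j => (A j + b * D j - mu) + mu)); last first.
    by apply/funext => j /=; rewrite subrK.
  by apply: cvgD; [exact: ex0|exact: cvg_cst].
have eE k : e k = (A k + b * D k - mu)%:E by rewrite /e LE phiE -dEFinB.
have [fin_case lin_case sub_case] := kl_exponent_rates fs hs xs b0 m0 xr0 desc coer
  gfin xmin ph_lb ph_lev eta'0 cpsi' kappa0 th01 kl' zU' limA.
split.
- move=> /fin_case[h1 h2]; split=> //.
  by apply: filterS h1 => k; rewrite eE => ->.
- move=> /lin_case[c1 [chat1 [Q1 [Qhat1 [h1 h2 h3 h4 h5]]]]].
  exists c1, chat1, Q1, Qhat1; split=> //.
  by apply: filterS h5 => k [h6 h7]; rewrite eE lee_fin.
- move=> /andP[/sub_case[c2 [chat2 [h1 h2 h3]]] _].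
  exists c2, chat2; split=> //.
  by apply: filterS h3 => k [h6 h7]; rewrite eE lee_fin.
Qed.
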